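(* Let $A$ be a bialgebra in $\mathcal C$ and $\Omega(A)=(H,\phi_H,\varphi_A,\tau)$ an extending datum of $A$ such that $\delta_H$ and $\varepsilon_H$ are multiplicative, $(H,\phi_H)$ is a right $A$-module, and, for $\psi_{H}^{A}=(\varphi_{A}\otimes \phi_{H})\circ\delta_{H\otimes A}$ and $\sigma_{H}^{A}=(\tau\otimes \mu_{H})\circ \delta_{H\otimes H}$, the following equalities hold: (BE1) $\mu_{H}\circ (\mu_{H}\otimes H)=\mu_{H}\circ (\phi_{H}\otimes H)\circ (H\otimes \sigma_{H}^{A})$; (BE2) $\varphi_{A}\circ (H\otimes \mu_{A})=\mu_{A}\circ (A\otimes \varphi_{A})\circ (\psi_{H}^{A}\otimes A)$; (BE3) $\phi_{H}\circ (\mu_{H}\otimes A)=\mu_{H}\circ (\phi_{H}\otimes H)\circ (H\otimes \psi_{H}^{A})$; (BE4) $\mu_{A}\circ (A\otimes \tau)\circ (\psi_{H}^{A}\otimes H)\circ (H\otimes \psi_{H}^{A})=\mu_{A}\circ (A\otimes \varphi_{A})\circ (\sigma_{H}^{A}\otimes A)$; (BE5) $\mu_{A}\circ (A\otimes \tau)\circ (\psi_{H}^{A}\otimes H)\circ (H\otimes \sigma_{H}^{A})=\mu_{A}\circ (A\otimes \tau)\circ (\sigma_{H}^{A}\otimes H)$; (BE6) $c_{A,H}\circ \psi_{H}^{A}=(\phi_{H}\otimes \varphi_{A})\circ \delta_{H\otimes A}$; (BE7) $c_{A,H}\circ \sigma_{H}^{A}=(\mu_{H}\otimes \tau)\circ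 \delta_{H\otimes H}$. Then, with $\mu_{A\otimes H} = (\mu_A\otimes H)\circ (\mu_A\otimes \sigma_{H}^{A})\circ (A\otimes \psi_{H}^{A}\otimes H)$, the pair $(A\otimes H,\mu_{A\otimes H})$ is a weak crossed product (the one induced by the quadruple $(A,H,\psi_H^A,\sigma_H^A)$), its associated idempotent is $\nabla_{A\otimes H}=id_{A\otimes H}$, and $$\mu_{A\otimes H}\circ (\eta_{A}\otimes \eta_{H}\otimes A\otimes H)=id_{A\otimes H}=\mu_{A\otimes H}\circ(A\otimes H\otimes \eta_{A}\otimes \eta_{H}),$$ so that $(A\otimes H,\eta_{A\otimes H}=\eta_A\otimes\eta_H,\mu_{A\otimes H})$ is an algebra in $\mathcal C$. Moreover, when $\mathcal C$ is the category of $k$-modules, $\mu_{A\otimes H}$ is the multiplication of the unified product, i.e. $(a\otimes h)\bullet (c\otimes g)=a(h_{(1)}\triangleright c_{(1)})\,\tau((h_{(2)}\triangleleft c_{(2)})\otimes g_{(1)})\otimes (h_{(3)}\triangleleft c_{(3)})\cdot g_{(2)}$, where $h\triangleright a=\varphi_A(h\otimes a)$, $h\triangleleft a=\phi_H(h\otimes a)$ and $h\cdot g=\mu_H(h\otimes g)$.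
   Context: $\mathcal C$ is a strict braided monoidal category with tensor product $\otimes$, base object $K$ and braiding $c$, in which every idempotent splits. For an object $X$ and a morphism $f$, $X\otimes f$ means $id_X\otimes f$ and $f\otimes X$ means $f\otimes id_X$. Algebras $(A,\eta_A,\mu_A)$ (unital, associative), coalgebras $(D,\varepsilon_D,\delta_D)$ and bialgebras are taken in $\mathcal C$. For coalgebras $D,E$, $\delta_{D\otimes E}=(D\otimes c_{D,E}\otimes E)\circ(\delta_D\otimes\delta_E)$ and $\varepsilon_{D\otimes E}=\varepsilon_D\otimes\varepsilon_E$. Extending datum of a bialgebra $A$: a system $\Omega(A)=(H, \phi_{H}:H\otimes A\to H, \varphi_{A}:H\otimes A\to A, \tau:H\otimes H\to A)$ where (i) there exist morphisms $\eta_{H}:K\to H$, $\mu_{H}:H\otimes H\to H$, $\varepsilon_{H}:H\to K$, $\delta_{H}:H\to H\otimes H$ such that $(H,\varepsilon_{H},\delta_{H})$ is a coalgebra, $\delta_{H}\circ \eta_{H}=\eta_{H}\otimes \eta_{H}$, and $\mu_{H}\circ (\eta_{H}\otimes H)=id_{H}=\mu_{H}\circ (H\otimes\eta_{H})$ ($\mu_H$ need not be associative); (ii)–(iv) $\phi_H:H\otimes A\to H$, $\varphi_A:H\otimes A\to A$ and $\tau:H\otimes H\to A$ are coalgebra morphisms; (v) $\varphi_{A}\circ (H\otimes\eta_{A})=\varepsilon_{H}\otimes \eta_{A}$; $\varphi_{A}\circ (\eta_{H}\otimes A)=id_{A}$; $\phi_{H}\circ (\eta_{H}\otimes A)=\eta_{H}\otimes\varepsilon_{A}$;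 $\phi_{H}\circ (H\otimes \eta_{A})=id_{H}$; $\tau\circ (H\otimes \eta_{H})=\tau\circ (\eta_{H}\otimes H)=\eta_{A}\otimes \varepsilon_{H}$. $\delta_H$ multiplicative means $\delta_{H}\circ \mu_{H}=\mu_{H\otimes H}\circ (\delta_{H}\otimes \delta_{H})$ with $\mu_{H\otimes H}=(\mu_H\otimes\mu_H)\circ(H\otimes c_{H,H}\otimes H)$; $\varepsilon_H$ multiplicative means $\varepsilon_{H}\circ \mu_{H}=\varepsilon_{H}\otimes \varepsilon_{H}$. $(H,\phi_H)$ is a right $A$-module if $\phi_{H}\circ(H\otimes\eta_{A})=id_{H}$ and $\phi_{H}\circ (\phi_{H}\otimes A)=\phi_{H}\circ(H\otimes \mu_{A})$. Weak crossed product: let $A$ be an algebra, $V$ an object, $\psi_V^A:V\otimes A\to A\otimes V$ and $\sigma_V^A:V\otimes V\to A\otimes V$ morphisms with $(\mu_A\otimes V)\circ (A\otimes \psi_{V}^{A})\circ(\psi_{V}^{A}\otimes A) = \psi_{V}^{A}\circ (V\otimes \mu_A)$. Then $\nabla_{A\otimes V} = (\mu_A\otimes V)\circ(A\otimes\psi_{V}^{A})\circ (A\otimes V\otimes \eta_A)$ is idempotent, and for all quadruples $(A,V,\psi_V^A,\sigma_V^A)$ one requires $\nabla_{A\otimes V}\circ\sigma_V^A=\sigma_V^A$. The twisted condition is $(\mu_A\otimes V)\circ (A\otimes \psi_{V}^{A})\circ(\sigma_{V}^{A}\otimes A) = (\mu_A\otimes V)\circ (A\otimes\sigma_{V}^{A})\circ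 (\psi_{V}^{A}\otimes V)\circ (V\otimes\psi_{V}^{A})$, and the cocycle condition is $(\mu_A\otimes V)\circ (A\otimes \sigma_{V}^{A}) \circ(\sigma_{V}^{A}\otimes V) = (\mu_A\otimes V)\circ (A\otimes\sigma_{V}^{A})\circ (\psi_{V}^{A}\otimes V)\circ(V\otimes\sigma_{V}^{A})$. If both hold, $(A\otimes V,\mu_{A\otimes V})$ with $\mu_{A\otimes V}=(\mu_A\otimes V)\circ (\mu_A\otimes\sigma_{V}^{A})\circ (A\otimes \psi_{V}^{A}\otimes V)$ is called a weak crossed product. *)

(* Defs.v *)
From mathcomp Require Import all_boot all_algebra.
Set Implicit Arguments.
Unset Strict Implicit.
Unset Printing Implicit Defensive.
Import GRing.Theory.

(* Strict monoidal categories satisfy X (x) (Y (x) Z) = (X (x) Y) (x) Z as an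
   equality of objects, which is awkward for a hom-set indexed family
   Hom X Y : Type.  We therefore use the single-sorted presentation: one type
   of all morphisms, with domain and codomain maps.  comp g f is the composite
   "g after f"; it is a total function, but its values on non-composable pairs
   are unspecified and no axiom constrains them. *)
Record strictBraidedCat : Type := StrictBraidedCat {
  ob : Type;
  mor : Type;
  dom : mor -> ob;
  cod : mor -> ob;
  idm : ob -> mor;
  comp : mor -> mor -> mor;
  dom_idm : forall X, dom (idm X) = X;
  cod_idm : forall X, cod (idm X) = X;
  dom_comp : forall g f, cod f = dom g -> dom (comp g f) = dom f;
  cod_comp : forall g f, cod f = dom g -> cod (comp g f) = cod g;
  comp_idl : forall f, comp (idm (cod f)) f = f;
  comp_idr : forall f, comp f (idm (dom f)) = f;
  comp_assoc : forall h g f, cod f = dom g -> cod g = dom h ->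
    comp h (comp g f) = comp (comp h g) f;
  unit_ob : ob;
  tob : ob -> ob -> ob;
  tmor : mor -> mor -> mor;
  dom_tmor : forall f g, dom (tmor f g) = tob (dom f) (dom g);
  cod_tmor : forall f g, cod (tmor f g) = tob (cod f) (cod g);
  tmor_idm : forall X Y, tmor (idm X) (idm Y) = idm (tob X Y);
  tmor_comp : forall g f g' f', cod f = dom g -> cod f' = dom g' ->
    tmor (comp g f) (comp g' f') = comp (tmor g g') (tmor f f');
  tob_assoc : forall X Y Z, tob X (tob Y Z) = tob (tob X Y) Z;
  tob_unitl : forall X, tob unit_ob X = X;
  tob_unitr : forall X, tob X unit_ob = X;
  tmor_assoc : forall f g h, tmor f (tmor g h) = tmor (tmor f g) h;
  tmor_unitl : forall f, tmor (idm unit_ob) f = f;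
  tmor_unitr : forall f, tmor f (idm unit_ob) = f;
  braid : ob -> ob -> mor;
  dom_braid : forall X Y, dom (braid X Y) = tob X Y;
  cod_braid : forall X Y, cod (braid X Y) = tob Y X;
  braid_iso : forall X Y, exists b,
    [/\ dom b = tob Y X, cod b = tob X Y,
        comp b (braid X Y) = idm (tob X Y) &
        comp (braid X Y) b = idm (tob Y X)];
  braid_nat : forall f g,
    comp (braid (cod f) (cod g)) (tmor f g) =
    comp (tmor g f) (braid (dom f) (dom g));
  braid_tobr : forall X Y Z, braid X (tob Y Z) =
    comp (tmor (idm Y) (braid X Z)) (tmor (braid X Y) (idm Z));
  braid_tobl : forall X Y Z, braid (tob X Y) Z =
    comp (tmor (braid X Z) (idm Y)) (tmor (idm X) (braid Y Z))
}.

Arguments idm {_} _.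
Arguments unit_ob {_}.
Arguments braid {_} _ _.

Declare Scope cat_scope.
Delimit Scope cat_scope with cat.
Bind Scope cat_scope with mor.
Bind Scope cat_scope with ob.

(* An object used as a morphism denotes its identity, so that X \ox f stands
   for idm X \ox f, and f \ox X for f \ox idm X. *)
Coercion idm : ob >-> mor.

Notation "X \Ox Y" := (tob X%cat Y%cat)
  (at level 40, left associativity) : cat_scope.
Notation "f \ox g" := (tmor f%cat g%cat)
  (at level 40, left associativity) : cat_scope.
Notation "g \oc f" := (comp g%cat f%cat)
  (at level 50, left associativity) : cat_scope.

Open Scope cat_scope.

Definition hom (C : strictBraidedCat) (f : mor C) (X Y : ob C) : Prop :=
  dom f = X /\ cod f = Y.

Notation "f '\is_hom' X ~> Y" := (hom f%cat X%cat Y%cat)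
  (at level 70, X at level 69, Y at level 69, no associativity) : cat_scope.

Definition idempotents_split (C : strictBraidedCat) : Prop :=
  forall (X : ob C) (e : mor C), e \is_hom X ~> X -> e \oc e = e ->
  exists (Z : ob C) (i p : mor C),
    [/\ i \is_hom Z ~> X, p \is_hom X ~> Z, i \oc p = e & p \oc i = idm Z].

Record algebra (C : strictBraidedCat) (A : ob C) (eta mu : mor C) : Prop :=
  Algebra {
  alg_eta : eta \is_hom unit_ob ~> A;
  alg_mu : mu \is_hom A \Ox A ~> A;
  alg_unitl : mu \oc (eta \ox A) = A;
  alg_unitr : mu \oc (A \ox eta) = A;
  alg_assoc : mu \oc (mu \ox A) = mu \oc (A \ox mu)
}.

Record coalgebra (C : strictBraidedCat) (D : ob C) (eps delta : mor C) : Prop :=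
  Coalgebra {
  coalg_eps : eps \is_hom D ~> unit_ob;
  coalg_delta : delta \is_hom D ~> D \Ox D;
  coalg_counitl : (eps \ox D) \oc delta = D;
  coalg_counitr : (D \ox eps) \oc delta = D;
  coalg_coassoc : (delta \ox D) \oc delta = (D \ox delta) \oc delta
}.

(* The (co)multiplication of a tensor product of (co)algebras. *)
Definition mul_tensor (C : strictBraidedCat) (A B : ob C) (muA muB : mor C) :
  mor C := (muA \ox muB) \oc (A \ox braid B A \ox B).

Definition comul_tensor (C : strictBraidedCat) (D E : ob C)
  (deltaD deltaE : mor C) : mor C :=
  (D \ox braid D E \ox E) \oc (deltaD \ox deltaE).

Record coalg_mor (C : strictBraidedCat) (D : ob C) (epsD deltaD : mor C)
  (E : ob C) (epsE deltaE : mor C) (f : mor C) : Prop := CoalgMor {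
  coalg_mor_hom : f \is_hom D ~> E;
  coalg_mor_eps : epsE \oc f = epsD;
  coalg_mor_delta : deltaE \oc f = (f \ox f) \oc deltaD
}.

Record bialgebra (C : strictBraidedCat) (A : ob C)
  (eta mu eps delta : mor C) : Prop := Bialgebra {
  bialg_alg : algebra A eta mu;
  bialg_coalg : coalgebra A eps delta;
  bialg_delta_eta : delta \oc eta = eta \ox eta;
  bialg_delta_mu : delta \oc mu = mul_tensor A A mu mu \oc (delta \ox delta);
  bialg_eps_eta : eps \oc eta = unit_ob;
  bialg_eps_mu : eps \oc mu = eps \ox eps
}.

Record extending_datum (C : strictBraidedCat)
  (A : ob C) (etaA muA epsA deltaA : mor C)
  (H : ob C) (etaH muH epsH deltaH : mor C)
  (phiH phiA tau : mor C) : Prop := ExtendingDatum {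
  ext_etaH : etaH \is_hom unit_ob ~> H;
  ext_muH : muH \is_hom H \Ox H ~> H;
  ext_coalg : coalgebra H epsH deltaH;
  ext_delta_eta : deltaH \oc etaH = etaH \ox etaH;
  ext_mu_unitl : muH \oc (etaH \ox H) = H;
  ext_mu_unitr : muH \oc (H \ox etaH) = H;
  ext_phiH : coalg_mor (H \Ox A) (epsH \ox epsA) (comul_tensor H A deltaH deltaA)
                       H epsH deltaH phiH;
  ext_phiA : coalg_mor (H \Ox A) (epsH \ox epsA) (comul_tensor H A deltaH deltaA)
                       A epsA deltaA phiA;
  ext_tau : coalg_mor (H \Ox H) (epsH \ox epsH) (comul_tensor H H deltaH deltaH)
                      A epsA deltaA tau;
  ext_phiA_eta : phiA \oc (H \ox etaA) = epsH \ox etaA;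
  ext_phiA_unit : phiA \oc (etaH \ox A) = A;
  ext_phiH_eta : phiH \oc (etaH \ox A) = etaH \ox epsA;
  ext_phiH_unit : phiH \oc (H \ox etaA) = H;
  ext_tau_unitr : tau \oc (H \ox etaH) = etaA \ox epsH;
  ext_tau_unitl : tau \oc (etaH \ox H) = etaA \ox epsH
}.

Record right_module (C : strictBraidedCat) (A : ob C) (etaA muA : mor C)
  (M : ob C) (phi : mor C) : Prop := RightModule {
  rmod_hom : phi \is_hom M \Ox A ~> M;
  rmod_unit : phi \oc (M \ox etaA) = M;
  rmod_assoc : phi \oc (phi \ox A) = phi \oc (M \ox muA)
}.

(* The endomorphism nabla of A (x) V attached to psi : V (x) A -> A (x) V. *)
Definition nabla (C : strictBraidedCat) (A : ob C) (etaA muA : mor C)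
  (V : ob C) (psi : mor C) : mor C :=
  (muA \ox V) \oc (A \ox psi) \oc (A \ox V \ox etaA).

(* (A, V, psi, sigma) satisfies the standing requirements on quadruples. *)
Record wcp_quadruple (C : strictBraidedCat) (A : ob C) (etaA muA : mor C)
  (V : ob C) (psi sigma : mor C) : Prop := WcpQuadruple {
  quad_alg : algebra A etaA muA;
  quad_psi : psi \is_hom V \Ox A ~> A \Ox V;
  quad_sigma : sigma \is_hom V \Ox V ~> A \Ox V;
  quad_psi_mu : (muA \ox V) \oc (A \ox psi) \oc (psi \ox A) =
                psi \oc (V \ox muA);
  quad_nabla_sigma : nabla A etaA muA V psi \oc sigma = sigma
}.

Definition twisted_condition (C : strictBraidedCat) (A : ob C) (muA : mor C)
  (V : ob C) (psi sigma : mor C) : Prop :=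
  (muA \ox V) \oc (A \ox psi) \oc (sigma \ox A) =
  (muA \ox V) \oc (A \ox sigma) \oc (psi \ox V) \oc (V \ox psi).

Definition cocycle_condition (C : strictBraidedCat) (A : ob C) (muA : mor C)
  (V : ob C) (psi sigma : mor C) : Prop :=
  (muA \ox V) \oc (A \ox sigma) \oc (sigma \ox V) =
  (muA \ox V) \oc (A \ox sigma) \oc (psi \ox V) \oc (V \ox sigma).

Definition wcp_mul (C : strictBraidedCat) (A : ob C) (muA : mor C)
  (V : ob C) (psi sigma : mor C) : mor C :=
  (muA \ox V) \oc (muA \ox sigma) \oc (A \ox psi \ox V).

(* (A (x) V, mu) is the weak crossed product induced by (A, V, psi, sigma). *)
Record weak_crossed_product (C : strictBraidedCat) (A : ob C)
  (etaA muA : mor C) (V : ob C) (psi sigma mu : mor C) : Prop :=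
  WeakCrossedProduct {
  wcp_quad : wcp_quadruple A etaA muA V psi sigma;
  wcp_twisted : twisted_condition A muA V psi sigma;
  wcp_cocycle : cocycle_condition A muA V psi sigma;
  wcp_mulE : mu = wcp_mul A muA V psi sigma
}.

(* The usual category of k-modules is monoidal but not strict, so "C is the
   category of k-modules" means that the strict braided category C is a strict
   form of it: C comes with a fully faithful, essentially surjective, strong monoidal, braided functor to
   k-modules, for the usual tensor product over k and the flip.
   - carrier X is the k-module X, and ap X Y f the linear map it underlies
     when f is a morphism from X to Y (no constraint is put on ap X Y f
     otherwise);
   - pure x y is the pure tensor of x and y; the map pure is characterized by
     the universal property of the tensor product;
   - for equal objects X and Y, ap X Y (idm X) is the identification of
     carrier X with carrier Y; pure_assoc, pure_unitl and pure_unitr say that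
     these identifications are the usual associativity and unit isomorphisms
     of the tensor product of modules.
   Mac Lane's strictification of the category of k-modules (objects are finite
   lists of modules, a list standing for its iterated tensor product) is such
   a C. *)
Record kmodules (k : comPzRingType) (C : strictBraidedCat) : Type := Kmodules {
  carrier :> ob C -> lmodType k;
  ap : forall X Y : ob C, mor C -> carrier X -> carrier Y;
  ap_linear : forall X Y f, f \is_hom X ~> Y -> linear (@ap X Y f);
  ap_id : forall X x, @ap X X (idm X) x = x;
  ap_comp : forall X Y Z f g x, f \is_hom X ~> Y -> g \is_hom Y ~> Z ->
    @ap X Z (g \oc f) x = @ap Y Z g (@ap X Y f x);
  ap_faithful : forall X Y f g, f \is_hom X ~> Y -> g \is_hom X ~> Y ->
    @ap X Y f =1 @ap X Y g -> f = g;
  ap_full : forall X Y (L : carrier X -> carrier Y), linear L ->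
    exists2 f, f \is_hom X ~> Y & @ap X Y f =1 L;
  carrier_surj : forall M : lmodType k, exists X (L : carrier X -> M),
    linear L /\ bijective L;
  one_tensor : carrier unit_ob;
  one_tensor_bij : bijective (fun r : k => (r *: one_tensor)%R);
  pure : forall X Y : ob C, carrier X -> carrier Y -> carrier (X \Ox Y);
  pure_linearr : forall X Y (x : carrier X), linear (@pure X Y x);
  pure_linearl : forall X Y (y : carrier Y), linear (fun x => @pure X Y x y);
  pure_universal : forall X Y (W : lmodType k)
    (b : carrier X -> carrier Y -> W),
    (forall x, linear (b x)) -> (forall y, linear (fun x => b x y)) ->
    exists L : carrier (X \Ox Y) -> W,
      [/\ linear L, forall x y, L (pure x y) = b x y &
          forall L' : carrier (X \Ox Y) -> W, linear L' ->
            (forall x y, L' (pure x y) = b x y) -> L' =1 L];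
  pure_assoc : forall X Y Z (x : carrier X) (y : carrier Y) (z : carrier Z),
    @ap ((X \Ox Y) \Ox Z) (X \Ox (Y \Ox Z)) (idm ((X \Ox Y) \Ox Z))
       (pure (pure x y) z) = pure x (pure y z);
  pure_unitl : forall X (x : carrier X),
    @ap (unit_ob \Ox X) X (idm X) (pure one_tensor x) = x;
  pure_unitr : forall X (x : carrier X),
    @ap (X \Ox unit_ob) X (idm X) (pure x one_tensor) = x;
  ap_tmor : forall X X' Y Y' f g (x : carrier X) (y : carrier Y),
    f \is_hom X ~> X' -> g \is_hom Y ~> Y' ->
    @ap (X \Ox Y) (X' \Ox Y') (f \ox g) (pure x y) =
    pure (@ap X X' f x) (@ap Y Y' g y);
  ap_braid : forall X Y (x : carrier X) (y : carrier Y),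
    @ap (X \Ox Y) (Y \Ox X) (braid X Y) (pure x y) = pure y x
}.

Arguments ap {k C} _ _ _ _ _.
Arguments pure {k C} _ {X Y} _ _.

Section Elements.
Local Open Scope ring_scope.
Variables (k : comPzRingType) (C : strictBraidedCat) (M : kmodules k C).

(* The bilinear operation underlying m : X (x) Y -> Z. *)
Definition op2 (X Y Z : ob C) (m : mor C) (x : M X) (y : M Y) : M Z :=
  ap M (X \Ox Y)%cat Z m (pure M x y).

(* s is a Sweedler expansion of the coproduct of x, i.e., the list of the
   (x_(1), x_(2)) in delta(x) = sum x_(1) (x) x_(2); likewise below for the
   list of the (x_(1), x_(2), x_(3)).  Such expansions are not unique. *)
Definition sweedler2 (X : ob C) (delta : mor C) (x : M X)
  (s : seq (M X * M X)) : Prop :=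
  ap M X (X \Ox X)%cat delta x = \sum_(t <- s) pure M t.1 t.2.

Definition sweedler3 (X : ob C) (delta : mor C) (x : M X)
  (s : seq (M X * M X * M X)) : Prop :=
  ap M X (X \Ox (X \Ox X))%cat ((X \ox delta) \oc delta)%cat x =
  \sum_(t <- s) pure M t.1.1 (pure M t.1.2 t.2).

End Elements.

Arguments op2 {k C} M {X Y Z} _ _ _.
Arguments sweedler2 {k C} M {X} _ _ _.
Arguments sweedler3 {k C} M {X} _ _ _.

(* mu is the multiplication of the unified product of A and H:
   (a (x) h)(c (x) g) = a (h1 |> c1) tau((h2 <| c2) (x) g1) (x) (h3 <| c3).g2,
   with |> given by phiA, <| by phiH and . by muH; the sums implicit in the
   right-hand side may be taken over any Sweedler expansions of h, c and g. *)
Definition unified_product_mul (k : comPzRingType) (C : strictBraidedCat)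
  (M : kmodules k C) (A : ob C) (muA deltaA : mor C)
  (H : ob C) (muH deltaH phiH phiA tau mu : mor C) : Prop :=
  let mulA (x y : M A) : M A := op2 M muA x y in
  let ract (h : M H) (x : M A) : M A := op2 M phiA h x in
  let lact (h : M H) (x : M A) : M H := op2 M phiH h x in
  let dot (h g : M H) : M H := op2 M muH h g in
  let cocyc (h g : M H) : M A := op2 M tau h g in
  forall (a c : M A) (h g : M H)
    (hs : seq (M H * M H * M H)) (cs : seq (M A * M A * M A))
    (gs : seq (M H * M H)),
  sweedler3 M deltaH h hs -> sweedler3 M deltaA c cs ->
  sweedler2 M deltaH g gs ->
  (op2 M mu (pure M a h) (pure M c g) : M (A \Ox H)) =
  (\sum_(t <- hs) \sum_(u <- cs) \sum_(v <- gs)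
     pure M (mulA (mulA a (ract t.1.1 u.1.1))
                  (cocyc (lact t.1.2 u.1.2) v.1))
            (dot (lact t.2 u.2) v.2))%R.

(* Main.v *)
Require Import Defs.
From mathcomp Require Import all_boot all_algebra.

(* A coalgebra morphism u into A (x) H is recovered from its two projections
   (A (x) eps_H) u and (eps_A (x) H) u.  By BE6 and BE7, psi and sigma are
   coalgebra morphisms, hence so are both sides of the compatibility of psi with
   mu_A, of the twisted condition, of the cocycle condition and of the unit
   laws.  It is therefore enough to compare projections: these are BE2 and the
   module axiom, BE4 and BE3, BE5 and BE1, and the unit axioms of the extending
   datum, respectively.  Associativity of the crossed product is then the usual
   consequence of the first three conditions. *)

Set Implicit Arguments.
Unset Strict Implicit.
Unset Printing Implicit Defensive.

(** The obstacle is bookkeeping: associativity of the tensor product is an equality of objects and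
    composition is meaningful only on composable pairs, so an equation to be applied inside a long
    composite is hidden by brackets, interchange and typing conditions. A reflective normal form for
    string diagrams discharges all of these. A calculation is then a chain of [transitivity] steps
    that make one side of an equation appear literally, each followed by a [rewrite]. Naturality of
    the braiding lies outside the normal form and enters by explicit instances of [braid_natural].
    The extension principle compares two morphisms over the same coalgebra, so the comultiplications
    of iterated tensor products must also be rebracketed. The obstacle returns for elements of
    modules, where rebracketing a pure tensor changes its type. *)

(** * Typing, unit laws and interchange in a strict braided category *)

Lemma hom_idm (C : strictBraidedCat) (X : ob C) : X \is_hom X ~> X.
Proof. by split; rewrite ?dom_idm ?cod_idm. Qed.

Lemma hom_comp (C : strictBraidedCat) (X Y Z : ob C) (f g : mor C) :
  f \is_hom X ~> Y -> g \is_hom Y ~> Z -> g \oc f \is_hom X ~> Z.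
Proof. by move=> [? cf] [dg ?]; split; rewrite ?dom_comp ?cod_comp ?cf. Qed.

Lemma hom_tmor (C : strictBraidedCat) (X Y X' Y' : ob C) (f f' : mor C) :
  f \is_hom X ~> Y -> f' \is_hom X' ~> Y' ->
  f \ox f' \is_hom X \Ox X' ~> Y \Ox Y'.
Proof. by move=> [? ?] [? ?]; split; rewrite ?dom_tmor ?cod_tmor; congr tob. Qed.

Lemma hom_braid (C : strictBraidedCat) (X Y : ob C) :
  braid X Y \is_hom X \Ox Y ~> Y \Ox X.
Proof. by split; rewrite ?dom_braid ?cod_braid. Qed.

Lemma idm_comp (C : strictBraidedCat) (X Y : ob C) (f : mor C) :
  f \is_hom X ~> Y -> idm Y \oc f = f.
Proof. by case=> _ <-; exact: comp_idl. Qed.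

Lemma comp_idm (C : strictBraidedCat) (X Y : ob C) (f : mor C) :
  f \is_hom X ~> Y -> f \oc idm X = f.
Proof. by case=> <- _; exact: comp_idr. Qed.

Lemma hom_compA (C : strictBraidedCat) (X Y Z T : ob C) (f g h : mor C) :
  f \is_hom X ~> Y -> g \is_hom Y ~> Z -> h \is_hom Z ~> T ->
  h \oc (g \oc f) = h \oc g \oc f.
Proof. by move=> [_ cf] [dg cg] [dh _]; rewrite comp_assoc ?cf ?cg. Qed.

Lemma hom_tmor_comp (C : strictBraidedCat) (X Y Z X' Y' Z' : ob C)
    (f g f' g' : mor C) :
  f \is_hom X ~> Y -> g \is_hom Y ~> Z ->
  f' \is_hom X' ~> Y' -> g' \is_hom Y' ~> Z' ->
  (g \oc f) \ox (g' \oc f') = (g \ox g') \oc (f \ox f').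
Proof. by move=> [_ cf] [dg _] [_ cf'] [dg' _]; rewrite tmor_comp ?cf ?cf'. Qed.

(** The hexagon at two unit objects says that this braiding is idempotent, and an invertible
    idempotent is an identity. *)
Lemma braid_unitr (C : strictBraidedCat) (X : ob C) : braid X unit_ob = idm X.
Proof.
have := braid_tobr X (unit_ob : ob C) unit_ob.
rewrite tob_unitl tmor_unitl tmor_unitr => E.
have [b [db cb bK _]] := braid_iso X (unit_ob : ob C).
have dc := dom_braid X (unit_ob : ob C); have cc := cod_braid X (unit_ob : ob C).
rewrite tob_unitl tob_unitr in dc cc db cb bK.
have := congr1 (fun x => b \oc x) E; rewrite comp_assoc ?cc ?dc // bK.
by rewrite (@idm_comp _ X X) // => <-.
Qed.

Lemma braid_unitl (C : strictBraidedCat) (X : ob C) : braid unit_ob X = idm X.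
Proof.
have := braid_tobl (unit_ob : ob C) unit_ob X.
rewrite tob_unitl tmor_unitl tmor_unitr => E.
have [b [db cb bK _]] := braid_iso (unit_ob : ob C) X.
have dc := dom_braid (unit_ob : ob C) X; have cc := cod_braid (unit_ob : ob C) X.
rewrite tob_unitl tob_unitr in dc cc db cb bK.
have := congr1 (fun x => b \oc x) E; rewrite comp_assoc ?cc ?dc // bK.
by rewrite (@idm_comp _ X X) // => <-.
Qed.

(** * Equality up to the strict monoidal axioms and the hexagons, by reflection *)

Section Diagrams.
Variable C : strictBraidedCat.
Implicit Types (X Y : ob C) (f g : mor C) (s t : seq (ob C)).

(** Lists of factors make brackets and unit objects disappear; strictness identifies every object
    with the product of its list. *)
Definition tobs s : ob C := foldr (fun X Y => X \Ox Y) unit_ob s.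

Lemma tobs_cat s t : tobs (s ++ t) = tobs s \Ox tobs t.
Proof. by elim: s => [|X s IH] /=; rewrite ?tob_unitl // IH tob_assoc. Qed.

Inductive obexp := OAtom of ob C | OUnit | OTensor of obexp & obexp.

Fixpoint obval (o : obexp) : ob C :=
  match o with
  | OAtom X => X
  | OUnit => unit_ob
  | OTensor o1 o2 => obval o1 \Ox obval o2
  end.

Fixpoint flat (o : obexp) : seq (ob C) :=
  match o with
  | OAtom X => [:: X]
  | OUnit => [::]
  | OTensor o1 o2 => flat o1 ++ flat o2
  end.

Lemma tobs_flat o : tobs (flat o) = obval o.
Proof. by elim: o => [X||o1 IH1 o2 IH2] //=; rewrite ?tob_unitr // tobs_cat IH1 IH2. Qed.

(** A generator carries its source and target, since [dom] and [cod] do not compute on an abstract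
    morphism. *)
Inductive morexp :=
  | MId of obexp
  | MAtom of mor C & obexp & obexp
  | MBraid of obexp & obexp
  | MComp of morexp & morexp
  | MTensor of morexp & morexp.

Fixpoint morval (m : morexp) : mor C :=
  match m with
  | MId o => idm (obval o)
  | MAtom f _ _ => f
  | MBraid o1 o2 => braid (obval o1) (obval o2)
  | MComp m1 m2 => morval m1 \oc morval m2
  | MTensor m1 m2 => morval m1 \ox morval m2
  end.

Fixpoint mdom (m : morexp) : seq (ob C) :=
  match m with
  | MId o => flat o
  | MAtom _ o _ => flat o
  | MBraid o1 o2 => flat o1 ++ flat o2
  | MComp _ m2 => mdom m2
  | MTensor m1 m2 => mdom m1 ++ mdom m2
  end.

Fixpoint mcod (m : morexp) : seq (ob C) :=
  match m with
  | MId o => flat o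
  | MAtom _ _ o => flat o
  | MBraid o1 o2 => flat o2 ++ flat o1
  | MComp m1 _ => mcod m1
  | MTensor m1 m2 => mcod m1 ++ mcod m2
  end.

Fixpoint mtyped (m : morexp) : Prop :=
  match m with
  | MId _ | MBraid _ _ => True
  | MAtom f o1 o2 => f \is_hom obval o1 ~> obval o2
  | MComp m1 m2 => [/\ mtyped m1, mtyped m2 & mcod m2 = mdom m1]
  | MTensor m1 m2 => mtyped m1 /\ mtyped m2
  end.

Lemma morval_hom m : mtyped m -> morval m \is_hom tobs (mdom m) ~> tobs (mcod m).
Proof.
elim: m => [o|f o1 o2|o1 o2|m1 IH1 m2 IH2|m1 IH1 m2 IH2] /=.
- by move=> _; rewrite tobs_flat; exact: hom_idm.
- by rewrite !tobs_flat.
- by move=> _; rewrite !tobs_cat !tobs_flat; exact: hom_braid.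
- by move=> [/IH1 h1 /IH2 h2 E]; apply: hom_comp h2 _; rewrite E.
- by move=> [/IH1 h1 /IH2 h2]; rewrite !tobs_cat; exact: hom_tmor.
Qed.

Lemma hom_reflect m o1 o2 : mtyped m -> mdom m = flat o1 -> mcod m = flat o2 ->
  morval m \is_hom obval o1 ~> obval o2.
Proof. by move=> /morval_hom + d c; rewrite d c !tobs_flat. Qed.

(** One row of a string diagram: a single box [lmor] with identity wires on both sides. *)
Record layer := Layer {
  lleft : seq (ob C); lmor : mor C; lin : seq (ob C); lout : seq (ob C);
  lright : seq (ob C) }.

Definition lval (a : layer) : mor C :=
  tobs (lleft a) \ox (lmor a \ox tobs (lright a)).
Definition ldom (a : layer) := lleft a ++ lin a ++ lright a.
Definition lcod (a : layer) := lleft a ++ lout a ++ lright a.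
Definition ltyped (a : layer) := lmor a \is_hom tobs (lin a) ~> tobs (lout a).

Lemma lval_hom a : ltyped a -> lval a \is_hom tobs (ldom a) ~> tobs (lcod a).
Proof.
move=> ha; rewrite /ldom /lcod !tobs_cat.
exact: hom_tmor (hom_idm _) (hom_tmor ha (hom_idm _)).
Qed.

(* A diagram is a list of layers, the first layer being applied first. *)
Fixpoint dval s (d : seq layer) : mor C :=
  if d is a :: d' then dval (lcod a) d' \oc lval a else idm (tobs s).

Fixpoint dcod s (d : seq layer) : seq (ob C) :=
  if d is a :: d' then dcod (lcod a) d' else s.

Fixpoint dtyped s (d : seq layer) : Prop :=
  if d is a :: d' then [/\ ltyped a, s = ldom a & dtyped (lcod a) d'] else True.

Lemma dval_hom s d : dtyped s d -> dval s d \is_hom tobs s ~> tobs (dcod s d).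
Proof.
elim: d s => [|a d IH] s /=; first by move=> _; exact: hom_idm.
by move=> [/lval_hom ha -> /IH]; exact: hom_comp.
Qed.

Lemma dcod_cat s d1 d2 : dcod s (d1 ++ d2) = dcod (dcod s d1) d2.
Proof. by elim: d1 s => /=. Qed.

Lemma dtyped_cat s d1 d2 :
  dtyped s d1 -> dtyped (dcod s d1) d2 -> dtyped s (d1 ++ d2).
Proof. by elim: d1 s => //= a d1 IH s [? ? /IH h] /h. Qed.

Lemma dval_cat s d1 d2 : dtyped s d1 -> dtyped (dcod s d1) d2 ->
  dval s (d1 ++ d2) = dval (dcod s d1) d2 \oc dval s d1.
Proof.
elim: d1 s => [|a d1 IH] s /=.
  by move=> _ /dval_hom/comp_idm ->.
move=> [ta _ t1] t2; rewrite IH //.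
exact: esym (hom_compA (lval_hom ta) (dval_hom t1) (dval_hom t2)).
Qed.

Definition whiskerl s (a : layer) :=
  Layer (s ++ lleft a) (lmor a) (lin a) (lout a) (lright a).
Definition whiskerr s (a : layer) :=
  Layer (lleft a) (lmor a) (lin a) (lout a) (lright a ++ s).

Lemma whiskerl_dcod s t d :
  dcod (s ++ t) (map (whiskerl s) d) = s ++ dcod t d.
Proof. by elim: d t => //= a d IH t; rewrite -IH /lcod /= !catA. Qed.

Lemma whiskerr_dcod s t d :
  dcod (t ++ s) (map (whiskerr s) d) = dcod t d ++ s.
Proof. by elim: d t => //= a d IH t; rewrite -IH /lcod /= !catA. Qed.

Lemma whiskerl_dtyped s t d :
  dtyped t d -> dtyped (s ++ t) (map (whiskerl s) d).
Proof.
elim: d t => //= a d IH t [? -> /IH h]; split=> //.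
- by rewrite /ldom /= !catA.
- by move: h; rewrite /lcod /= !catA.
Qed.

Lemma whiskerr_dtyped s t d :
  dtyped t d -> dtyped (t ++ s) (map (whiskerr s) d).
Proof.
elim: d t => //= a d IH t [? -> /IH h]; split=> //.
- by rewrite /ldom /= !catA.
- by move: h; rewrite /lcod /= !catA.
Qed.

Lemma whiskerl_dval s t d : dtyped t d ->
  dval (s ++ t) (map (whiskerl s) d) = tobs s \ox dval t d.
Proof.
elim: d t => [|a d IH] t /=; first by rewrite tobs_cat tmor_idm.
move=> [ta _ td].
rewrite -{1}(comp_idm (hom_idm (tobs s))).
rewrite (hom_tmor_comp (hom_idm _) (hom_idm _) (lval_hom ta) (dval_hom td)) -IH //.
congr (_ \oc _); first by rewrite /lcod /= -!catA.
by rewrite /lval /= tobs_cat -tmor_idm -!tmor_assoc.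
Qed.

Lemma whiskerr_dval s t d : dtyped t d ->
  dval (t ++ s) (map (whiskerr s) d) = dval t d \ox tobs s.
Proof.
elim: d t => [|a d IH] t /=; first by rewrite tobs_cat tmor_idm.
move=> [ta _ td].
rewrite -{1}(comp_idm (hom_idm (tobs s))).
rewrite (hom_tmor_comp (lval_hom ta) (dval_hom td) (hom_idm _) (hom_idm _)) -IH //.
congr (_ \oc _); first by rewrite /lcod /= -!catA.
by rewrite /lval /= tobs_cat -tmor_idm !tmor_assoc.
Qed.

(** The hexagon [braid_tobr] read as a program: [X] crosses one factor at a time. With [braids],
    which iterates [braid_tobl], only braidings of single factors remain as boxes. *)
Fixpoint braid1 X t : seq layer :=
  if t is Y :: t' then
    Layer [::] (braid X Y) [:: X; Y] [:: Y; X] t' :: map (whiskerl [:: Y]) (braid1 X t')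
  else [::].

Fixpoint braids s t : seq layer :=
  if s is X :: s' then
    map (whiskerl [:: X]) (braids s' t) ++ map (whiskerr s') (braid1 X t)
  else [::].

Lemma braid1P X t : [/\ dtyped (X :: t) (braid1 X t),
  dcod (X :: t) (braid1 X t) = t ++ [:: X] &
  dval (X :: t) (braid1 X t) = braid X (tobs t)].
Proof.
elim: t => [|Y t [t1 c1 v1]] /=; first by rewrite braid_unitr tob_unitr.
rewrite /ltyped /lcod /= !tob_unitr.
have := whiskerl_dtyped [:: Y] t1 => /= t2.
have := whiskerl_dcod [:: Y] (X :: t) (braid1 X t) => /= ->.
have := whiskerl_dval [:: Y] t1 => /= ->.
rewrite c1; split=> //; first by split=> //; exact: hom_braid.
by rewrite v1 /lval /= tob_unitr tmor_unitl -braid_tobr.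
Qed.

Lemma braidsP s t : [/\ dtyped (s ++ t) (braids s t),
  dcod (s ++ t) (braids s t) = t ++ s &
  dval (s ++ t) (braids s t) = braid (tobs s) (tobs t)].
Proof.
elim: s => [|X s [t1 c1 v1]] /=; first by rewrite braid_unitl cats0.
have [t2 c2 v2] := braid1P X t.
have := whiskerl_dtyped [:: X] t1 => /= t3.
have := whiskerl_dcod [:: X] (s ++ t) (braids s t) => /= c3.
have := whiskerr_dtyped s t2 => /= t4.
have := whiskerr_dcod s (X :: t) (braid1 X t) => /= c4.
have E : dcod (X :: s ++ t) (map (whiskerl [:: X]) (braids s t)) = (X :: t) ++ s.
  by rewrite c3 c1.
split.
- by apply: dtyped_cat => //; rewrite E.
- by rewrite dcod_cat E c4 c2 -catA.
- rewrite dval_cat // ?E // whiskerr_dval // v2.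
  have := whiskerl_dval [:: X] t1 => /= ->; rewrite v1 tob_unitr.
  by rewrite braid_tobl.
Qed.

(** In a tensor product the left factor acts first, over the source wires of the right factor; the
    right factor then acts beside the target wires of the left one. *)
Fixpoint layers (m : morexp) : seq layer :=
  match m with
  | MId _ => [::]
  | MAtom f o1 o2 => [:: Layer [::] f (flat o1) (flat o2) [::]]
  | MBraid o1 o2 => braids (flat o1) (flat o2)
  | MComp m1 m2 => layers m2 ++ layers m1
  | MTensor m1 m2 =>
    map (whiskerr (mdom m2)) (layers m1) ++ map (whiskerl (mcod m1)) (layers m2)
  end.

Lemma layersP m : mtyped m -> [/\ dtyped (mdom m) (layers m),
  dcod (mdom m) (layers m) = mcod m & dval (mdom m) (layers m) = morval m].
Proof.
elim: m => [o|f o1 o2|o1 o2|m1 IH1 m2 IH2|m1 IH1 m2 IH2] /=.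
- by move=> _; rewrite tobs_flat.
- move=> hf; rewrite /ltyped /ldom /lcod /lval /= !cats0 !tobs_flat.
  rewrite tmor_unitl tmor_unitr; split=> //; exact: idm_comp hf.
- by move=> _; have := braidsP (flat o1) (flat o2); rewrite !tobs_flat.
- move=> [/[dup] /IH1 [t1 c1 v1] h1 /IH2 [t2 c2 v2] E].
  split; first by apply: dtyped_cat => //; rewrite c2 E.
  + by rewrite dcod_cat c2 E.
  + by rewrite dval_cat // ?c2 ?E // v1 v2.
- move=> [/[dup] /morval_hom h1 /IH1 [t1 c1 v1] /[dup] /morval_hom h2 /IH2 [t2 c2 v2]].
  have t3 := whiskerr_dtyped (mdom m2) t1.
  have c3 := whiskerr_dcod (mdom m2) (mdom m1) (layers m1); rewrite c1 in c3.
  have t4 := whiskerl_dtyped (mcod m1) t2.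
  have c4 := whiskerl_dcod (mcod m1) (mdom m2) (layers m2); rewrite c2 in c4.
  split; first by apply: dtyped_cat => //; rewrite c3.
  + by rewrite dcod_cat c3 c4.
  + rewrite dval_cat // ?c3 // whiskerr_dval // whiskerl_dval // v1 v2.
    by rewrite -(hom_tmor_comp h1 (hom_idm _) (hom_idm _) h2) (idm_comp h1) (comp_idm h2).
Qed.

(* When [b], applied after [a], acts strictly to the left of [a], the two
   layers are exchanged. *)
Fixpoint push (a : layer) (d : seq layer) : seq layer :=
  if d is b :: d' then
    let k := size (lleft b ++ lin b) in
    if k <= size (lleft a) then
      let m := drop k (lleft a) in
      Layer (lleft b) (lmor b) (lin b) (lout b) (m ++ lin a ++ lright a) ::
      push (Layer (lleft b ++ lout b ++ m) (lmor a) (lin a) (lout a) (lright a)) d'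
    else a :: d
  else [:: a].

(** By interchange both sides equal the tensor product of [l], [g], [m], [f] and [r]. *)
Lemma exchange (f g : mor C) i o i' o' l m r :
  f \is_hom tobs i ~> tobs o -> g \is_hom tobs i' ~> tobs o' ->
  lval (Layer l g i' o' (m ++ o ++ r)) \oc lval (Layer (l ++ i' ++ m) f i o r) =
  lval (Layer (l ++ o' ++ m) f i o r) \oc lval (Layer l g i' o' (m ++ i ++ r)).
Proof.
move=> hf hg; rewrite /lval /= !tobs_cat -!tmor_idm -!tmor_assoc.
have hI s : tobs s \is_hom tobs s ~> tobs s := hom_idm _.
have hfr := hom_tmor hf (hI r); have hir := hom_tmor (hI i) (hI r).
have hor := hom_tmor (hI o) (hI r).
have hmfr := hom_tmor (hI m) hfr; have hmir := hom_tmor (hI m) hir.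
have hmor := hom_tmor (hI m) hor.
rewrite -(hom_tmor_comp (hI l) (hI l) (hom_tmor (hI i') hmfr) (hom_tmor hg hmor)).
rewrite -(hom_tmor_comp (hI l) (hI l) (hom_tmor hg hmir) (hom_tmor (hI o') hmfr)).
rewrite -(hom_tmor_comp (hI i') hg hmfr hmor) -(hom_tmor_comp hg (hI o') hmir hmfr).
rewrite (idm_comp hg) (comp_idm hg).
rewrite -(hom_tmor_comp (hI m) (hI m) hfr hor) -(hom_tmor_comp (hI m) (hI m) hir hfr).
by rewrite !tmor_idm (idm_comp hfr) (comp_idm hfr).
Qed.

Lemma pushP s a d : dtyped s (a :: d) ->
  [/\ dtyped s (push a d), dcod s (push a d) = dcod s (a :: d) &
   dval s (push a d) = dval s (a :: d)].
Proof.
elim: d s a => // b d IH s a; rewrite [push _ _]/=; case: ifP => // hk.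
case: a hk => l f i o r; case: b => l' g i' o' r'.
rewrite /ldom /lcod /= => hk [tf -> [tg E td]].
(* [m] is the list of wires between the two boxes. Since [l' ++ i'] is no longer than [l], comparing
   prefixes and suffixes in [E] recovers [l] and [r']. *)
pose m := drop (size (l' ++ i')) l; rewrite -/m.
have El : l = l' ++ i' ++ m.
  rewrite catA /m -{1}(cat_take_drop (size (l' ++ i')) l); congr cat.
  have := congr1 (take (size (l' ++ i'))) E.
  by rewrite /lcod /ldom /= takel_cat // (catA l' i') take_size_cat.
have Er : r' = m ++ o ++ r.
  have := congr1 (drop (size (l' ++ i'))) E.
  by rewrite /lcod /ldom /= {1}El -!catA !(catA l' i') !drop_size_cat.
clearbody m; clear E hk; subst l r'.
have Ec : (l' ++ o' ++ m) ++ o ++ r = l' ++ o' ++ m ++ o ++ r by rewrite -!catA.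
have Ed : l' ++ o' ++ m ++ i ++ r = (l' ++ o' ++ m) ++ i ++ r by rewrite -!catA.
have [|t1 c1 v1] := IH (l' ++ o' ++ m ++ i ++ r) (Layer (l' ++ o' ++ m) f i o r).
  by split; rewrite /ldom /lcod /= ?Ec.
rewrite /= /lcod /= Ec in c1 v1; rewrite /lcod /= in td *.
split=> //; first by split=> //; rewrite /ldom /= -!catA.
have td' := dval_hom td.
have ha : lval (Layer (l' ++ o' ++ m) f i o r)
    \is_hom tobs (l' ++ o' ++ m ++ i ++ r) ~> tobs (l' ++ o' ++ m ++ o ++ r).
  by rewrite Ed -Ec; exact: (@lval_hom (Layer (l' ++ o' ++ m) f i o r) tf).
have hb := @lval_hom (Layer l' g i' o' (m ++ i ++ r)) tg.
have hf := @lval_hom (Layer (l' ++ i' ++ m) f i o r) tf.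
have hg := @lval_hom (Layer l' g i' o' (m ++ o ++ r)) tg.
rewrite /ldom /lcod /= in hb hf hg; rewrite -!catA in hf.
by rewrite v1 -(hom_compA hb ha td') -(hom_compA hf hg td') exchange.
Qed.

Fixpoint sort_once (d : seq layer) : seq layer :=
  if d is a :: d' then push a (sort_once d') else [::].

Lemma sort_onceP s d : dtyped s d ->
  [/\ dtyped s (sort_once d), dcod s (sort_once d) = dcod s d &
   dval s (sort_once d) = dval s d].
Proof.
elim: d s => //= a d IH s [ta -> /IH [t1 c1 v1]].
by have [|t2 c2 v2] := @pushP (ldom a) a (sort_once d); last rewrite c2 v2 /= c1 v1.
Qed.

(** One exchange can enable another, hence the repeated passes. Soundness holds after any number of
    passes, so the bound only affects which goals can be closed. *)
Definition normal (m : morexp) : seq layer :=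
  let d := layers m in iter (size d) sort_once d.

Lemma normalP m : mtyped m -> dval (mdom m) (normal m) = morval m.
Proof.
move=> /layersP [t _ <-]; rewrite /normal.
elim: (size _) => // n <- /=.
have [] // := @sort_onceP (mdom m) (iter n sort_once (layers m)).
by elim: n => //= n /sort_onceP [].
Qed.

Lemma normal_eq m1 m2 : mtyped m1 -> mtyped m2 -> mdom m1 = mdom m2 ->
  normal m1 = normal m2 -> morval m1 = morval m2.
Proof. by move=> /normalP <- /normalP <- -> ->. Qed.

End Diagrams.

(** * Translation of goals into string diagrams *)

Ltac reify_ob C X :=
  lazymatch X with
  | @unit_ob _ => constr:(@OUnit C)
  | @tob _ ?Y ?Z =>
    let y := reify_ob C Y in let z := reify_ob C Z in constr:(@OTensor C y z)
  | _ => constr:(@OAtom C X)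
  end.

Ltac reify_mor C f :=
  match goal with
  | _ : Defs.hom f ?X ?Y |- _ =>
    let x := reify_ob C X in let y := reify_ob C Y in constr:(@MAtom C f x y)
  | _ =>
    lazymatch f with
    | @idm _ ?X => let x := reify_ob C X in constr:(@MId C x)
    | @braid _ ?X ?Y =>
      let x := reify_ob C X in let y := reify_ob C Y in constr:(@MBraid C x y)
    | @Defs.comp _ ?g ?h =>
      let a := reify_mor C g in let b := reify_mor C h in constr:(@MComp C a b)
    | @tmor _ ?g ?h =>
      let a := reify_mor C g in let b := reify_mor C h in constr:(@MTensor C a b)
    | _ => fail 2 "cannot reify" f
    end
  end.

Ltac solve_typed :=
  cbv [mtyped mcod mdom flat obval cat];
  repeat lazymatch goal with |- and3 _ _ _ => split | |- _ /\ _ => split end;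
  first [exact: I | assumption | reflexivity].

(* Closes goals [f = g] that follow from the axioms of strict monoidal
   categories and the hexagons, and goals [f \is_hom X ~> Y]; naturality of the
   braiding is not used.  A morphism with a typing hypothesis in the context is
   treated as a generator. *)
Ltac diagram :=
  lazymatch goal with
  | |- @eq (mor ?C) ?f ?g =>
    let a := reify_mor C f in let b := reify_mor C g in
    apply: (@normal_eq C a b);
    [solve_typed | solve_typed | reflexivity | vm_compute; reflexivity]
  | |- @Defs.hom ?C ?f ?X ?Y =>
    let a := reify_mor C f in
    let x := reify_ob C X in let y := reify_ob C Y in
    apply: (@hom_reflect C a x y); [solve_typed | reflexivity | reflexivity]
  end.

(** * Coalgebra morphisms *)

Lemma braid_natural (C : strictBraidedCat) (X X' Y Y' : ob C) (f g : mor C) :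
  f \is_hom X ~> X' -> g \is_hom Y ~> Y' ->
  braid X' Y' \oc (f \ox g) = (g \ox f) \oc braid X Y.
Proof. by move=> [<- <-] [<- <-]; exact: braid_nat. Qed.

Section Coalgebras.
Variable C : strictBraidedCat.
Implicit Types (D E F : ob C).

Lemma coalgebra_unit : coalgebra (unit_ob : ob C) unit_ob unit_ob.
Proof. by split; try diagram. Qed.

Lemma coalg_mor_id D eps delta : coalgebra D eps delta ->
  coalg_mor D eps delta D eps delta D.
Proof. by move=> [he hd _ _ _]; split; diagram. Qed.

Lemma coalg_mor_comp D eD dD E eE dE F eF dF f g :
  coalgebra D eD dD -> coalgebra E eE dE -> coalgebra F eF dF ->
  coalg_mor D eD dD E eE dE f -> coalg_mor E eE dE F eF dF g ->
  coalg_mor D eD dD F eF dF (g \oc f).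
Proof.
move=> [heD hdD _ _ _] [heE hdE _ _ _] [heF hdF _ _ _] [hf fe fd] [hg ge gd].
split; first diagram.
- transitivity (eF \oc g \oc f); first diagram.
  by rewrite ge fe.
- transitivity (dF \oc g \oc f); first diagram.
  rewrite gd; transitivity ((g \ox g) \oc (dE \oc f)); first diagram.
  rewrite fd; diagram.
Qed.

Lemma comul_tensor_hom D dD E dE :
  dD \is_hom D ~> D \Ox D -> dE \is_hom E ~> E \Ox E ->
  comul_tensor D E dD dE \is_hom D \Ox E ~> D \Ox E \Ox D \Ox E.
Proof. by move=> hD hE; rewrite /comul_tensor; diagram. Qed.

(** The two sides differ only by the hexagons. The lemma lets one coalgebra structure serve both
    bracketings of a triple product. *)
Lemma comul_tensorA D dD E dE F dF :
  dD \is_hom D ~> D \Ox D -> dE \is_hom E ~> E \Ox E -> dF \is_hom F ~> F \Ox F ->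
  comul_tensor (D \Ox E) F (comul_tensor D E dD dE) dF =
  comul_tensor D (E \Ox F) dD (comul_tensor E F dE dF).
Proof. by move=> hD hE hF; rewrite /comul_tensor; diagram. Qed.

(* The braidings sort the factors of D D D E E E into D E D E D E. *)
Lemma comul_tensor_iterated D eD dD E eE dE :
  coalgebra D eD dD -> coalgebra E eE dE ->
  (D \Ox E \ox comul_tensor D E dD dE) \oc comul_tensor D E dD dE =
  (D \Ox E \Ox D \ox braid D E \ox E) \oc (D \ox braid (D \Ox D) E \ox E \ox E) \oc
  (((D \ox dD) \oc dD) \ox ((E \ox dE) \oc dE)).
Proof.
move=> [_ hD _ _ _] [_ hE _ _ _]; rewrite /comul_tensor.
have N := braid_natural hD (hom_idm E).
transitivity ((D \Ox E \Ox D \ox braid D E \ox E) \oc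
  (D \ox ((E \ox dD) \oc braid D E) \ox E \ox E) \oc
  (D \Ox D \Ox E \ox dE) \oc (dD \ox dE)); first diagram.
rewrite -N; diagram.
Qed.

Lemma coalgebra_tensor D eD dD E eE dE :
  coalgebra D eD dD -> coalgebra E eE dE ->
  coalgebra (D \Ox E) (eD \ox eE) (comul_tensor D E dD dE).
Proof.
move=> cD cE; have itr := comul_tensor_iterated cD cE.
case: cD cE itr => [heD hdD Dl Dr Da] [heE hdE El Er Ea] itr.
split; rewrite ?itr /comul_tensor; first diagram.
- diagram.
- have N := braid_natural (hom_idm D) heE.
  transitivity ((eD \ox ((eE \ox D) \oc braid D E) \ox E) \oc (dD \ox dE)); first diagram.
  rewrite -N; transitivity (((eD \ox D) \oc dD) \ox ((eE \ox E) \oc dE)); first diagram.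
  rewrite Dl El; diagram.
- have N := braid_natural heD (hom_idm E).
  transitivity ((D \ox ((E \ox eD) \oc braid D E) \ox eE) \oc (dD \ox dE)); first diagram.
  rewrite -N; transitivity (((D \ox eD) \oc dD) \ox ((E \ox eE) \oc dE)); first diagram.
  rewrite Dr Er; diagram.
(* [itr] has already sorted the right-hand side into coproducts followed by braidings; moving [dE]
   across the braiding sorts the left-hand side in the same way. *)
- have N := braid_natural (hom_idm D) hdE.
  rewrite -Da -Ea.
  transitivity ((D \ox braid D E \ox E \ox D \ox E) \oc
    (D \Ox D \ox ((dE \ox D) \oc braid D E) \ox E) \oc
    (dD \ox D \ox E \ox E) \oc (dD \ox dE)); first diagram.
  rewrite -N; diagram.
Qed.

Lemma coalg_mor_tensor D eD dD D' eD' dD' E eE dE E' eE' dE' f g :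
  coalgebra D eD dD -> coalgebra D' eD' dD' ->
  coalgebra E eE dE -> coalgebra E' eE' dE' ->
  coalg_mor D eD dD D' eD' dD' f -> coalg_mor E eE dE E' eE' dE' g ->
  coalg_mor (D \Ox E) (eD \ox eE) (comul_tensor D E dD dE)
    (D' \Ox E') (eD' \ox eE') (comul_tensor D' E' dD' dE') (f \ox g).
Proof.
move=> [heD hdD _ _ _] [heD' hdD' _ _ _] [heE hdE _ _ _] [heE' hdE' _ _ _].
move=> [hf fe fd] [hg ge gd]; rewrite /comul_tensor; split; first diagram.
- by rewrite -fe -ge; diagram.
- transitivity ((D' \ox braid D' E' \ox E') \oc ((dD' \oc f) \ox (dE' \oc g))).
    diagram.
  rewrite fd gd; have N := braid_natural hf hg.
  transitivity ((f \ox (braid D' E' \oc (f \ox g)) \ox g) \oc (dD \ox dE)).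
    diagram.
  rewrite N; diagram.
Qed.

(** Comultiplying gives factors in the order f f g g, while f g f g is wanted. Coassociativity lets
    the two middle factors come from a single coproduct, where the last hypothesis exchanges
    them. *)
Lemma coalg_mor_pair D eD dD A eA dA B eB dB f g :
  coalgebra D eD dD -> coalgebra A eA dA -> coalgebra B eB dB ->
  coalg_mor D eD dD A eA dA f -> coalg_mor D eD dD B eB dB g ->
  braid A B \oc ((f \ox g) \oc dD) = (g \ox f) \oc dD ->
  coalg_mor D eD dD (A \Ox B) (eA \ox eB) (comul_tensor A B dA dB)
    ((f \ox g) \oc dD).
Proof.
move=> [heD hdD Dl Dr Da] [heA hdA _ _ _] [heB hdB _ _ _] [hf fe fd] [hg ge gd] S.
rewrite /comul_tensor; split; first diagram.
- transitivity (((eA \oc f) \ox (eB \oc g)) \oc dD); first diagram.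
  rewrite fe ge; transitivity (eD \oc ((eD \ox D) \oc dD)); first diagram.
  rewrite Dl; diagram.
- transitivity ((A \ox braid A B \ox B) \oc ((dA \oc f) \ox (dB \oc g)) \oc dD).
    diagram.
  rewrite fd gd.
  transitivity ((f \ox (braid A B \oc (f \ox g)) \ox g) \oc (D \Ox D \ox dD) \oc
     ((dD \ox D) \oc dD)); first diagram.
  rewrite Da.
  transitivity ((f \ox (braid A B \oc (f \ox g)) \ox g) \oc
     (D \ox ((D \ox dD) \oc dD)) \oc dD); first diagram.
  (* The middle pair now comes from one [dD], so that [S] applies to it. *)
  rewrite -Da.
  transitivity ((f \ox (braid A B \oc ((f \ox g) \oc dD)) \ox g) \oc (D \ox dD) \oc dD).
    diagram.
  rewrite S.
  transitivity ((f \ox g \ox f \ox g) \oc (D \ox ((dD \ox D) \oc dD)) \oc dD).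
    diagram.
  rewrite Da.
  transitivity ((f \ox g \ox f \ox g) \oc (D \Ox D \ox dD) \oc ((D \ox dD) \oc dD)).
    diagram.
  rewrite -Da; diagram.
Qed.

Lemma pair_projl D eD dD A eA dA B eB dB f g :
  coalgebra D eD dD -> coalgebra A eA dA -> coalgebra B eB dB ->
  coalg_mor D eD dD A eA dA f -> coalg_mor D eD dD B eB dB g ->
  (A \ox eB) \oc ((f \ox g) \oc dD) = f.
Proof.
move=> [heD hdD Dl Dr _] [heA hdA _ _ _] [heB hdB _ _ _] [hf fe fd] [hg ge gd].
transitivity ((f \ox (eB \oc g)) \oc dD); first diagram.
rewrite ge; transitivity (f \oc ((D \ox eD) \oc dD)); first diagram.
rewrite Dr; diagram.
Qed.

Lemma pair_projr D eD dD A eA dA B eB dB f g :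
  coalgebra D eD dD -> coalgebra A eA dA -> coalgebra B eB dB ->
  coalg_mor D eD dD A eA dA f -> coalg_mor D eD dD B eB dB g ->
  (eA \ox B) \oc ((f \ox g) \oc dD) = g.
Proof.
move=> [heD hdD Dl Dr _] [heA hdA _ _ _] [heB hdB _ _ _] [hf fe fd] [hg ge gd].
transitivity (((eA \oc f) \ox g) \oc dD); first diagram.
rewrite fe; transitivity (g \oc ((eD \ox D) \oc dD)); first diagram.
rewrite Dl; diagram.
Qed.

(** Comultiplying in the tensor product and then applying [A \ox eB \ox eA \ox B] is the identity;
    compatibility of [u] with comultiplication moves this through [u]. *)
Lemma coalg_mor_pairE D eD dD A eA dA B eB dB u :
  coalgebra D eD dD -> coalgebra A eA dA -> coalgebra B eB dB ->
  coalg_mor D eD dD (A \Ox B) (eA \ox eB) (comul_tensor A B dA dB) u ->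
  u = (((A \ox eB) \oc u) \ox ((eA \ox B) \oc u)) \oc dD.
Proof.
move=> [heD hdD _ _ _] [heA hdA Al Ar Aa] [heB hdB Bl Br Ba] [hu ue ud].
transitivity ((A \ox eB \ox eA \ox B) \oc ((u \ox u) \oc dD)); last diagram.
rewrite -ud /comul_tensor; have N := braid_natural heA heB.
transitivity ((A \ox ((eB \ox eA) \oc braid A B) \ox B) \oc (dA \ox dB) \oc u);
  last diagram.
rewrite -N.
transitivity ((((A \ox eA) \oc dA) \ox ((eB \ox B) \oc dB)) \oc u); last diagram.
rewrite Ar Bl; diagram.
Qed.

Lemma coalg_mor_ext D eD dD A eA dA B eB dB u v :
  coalgebra D eD dD -> coalgebra A eA dA -> coalgebra B eB dB ->
  coalg_mor D eD dD (A \Ox B) (eA \ox eB) (comul_tensor A B dA dB) u ->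
  coalg_mor D eD dD (A \Ox B) (eA \ox eB) (comul_tensor A B dA dB) v ->
  (A \ox eB) \oc u = (A \ox eB) \oc v -> (eA \ox B) \oc u = (eA \ox B) \oc v ->
  u = v.
Proof.
move=> cD cA cB cu cv E1 E2.
by rewrite (coalg_mor_pairE cD cA cB cu) (coalg_mor_pairE cD cA cB cv) E1 E2.
Qed.

End Coalgebras.

(** * Weak crossed products *)

(** Both bracketings are reduced to one composite ending in [P2 \oc P1]: the left one by the twisted
    and then the cocycle condition, the right one by two uses of the compatibility of [psi] with
    [m]. Associativity of [m] regroups the factors in [A]. *)
Lemma wcp_mul_assoc (C : strictBraidedCat) (A : ob C) (eta m : mor C) (V : ob C)
    (psi sigma mu : mor C) :
  weak_crossed_product A eta m V psi sigma mu ->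
  mu \oc (mu \ox (A \Ox V)) = mu \oc ((A \Ox V) \ox mu).
Proof.
move=> [[[_ hm _ _ mA] hpsi hsigma psim _] tw cc ->].
rewrite /twisted_condition /cocycle_condition /wcp_mul in tw cc *.
(* a h b g c k |-> a b' h' g c k, where psi (h b) = b' h' *)
pose P1 := A \ox psi \ox V \ox A \ox V.
(* a b' h' g c k |-> a b' c'' h'' g' k *)
pose P2 := (A \ox A \ox psi \ox V \ox V) \oc (A \ox A \ox V \ox psi \ox V).
transitivity ((m \ox V) \oc ((m \oc (m \ox A)) \ox A \ox V) \oc (m \ox A \ox A \ox sigma)
  \oc (A \ox A \ox A \ox psi \ox V) \oc (A \ox A \ox sigma \ox A \ox V) \oc P1).
  by rewrite /P1; diagram.
rewrite mA.
transitivity ((m \ox V) \oc (m \ox sigma) \oc (m \ox A \ox V \ox V) \oc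
  (A \ox A \ox ((m \ox V) \oc (A \ox psi) \oc (sigma \ox A)) \ox V) \oc P1).
  by rewrite /P1; diagram.
rewrite tw.
transitivity ((m \ox V) \oc ((m \oc (A \ox m)) \ox sigma) \oc
  (m \ox A \ox sigma \ox V) \oc P2 \oc P1); first by rewrite /P1 /P2; diagram.
rewrite -mA.
transitivity (((m \oc (m \ox A)) \ox V) \oc (m \ox A \ox A \ox V) \oc
  (m \ox A \ox A \ox sigma) \oc (A \ox A \ox A \ox sigma \ox V) \oc P2 \oc P1).
  by rewrite /P1 /P2; diagram.
rewrite mA.
transitivity ((m \ox V) \oc (m \ox A \ox V) \oc (m \ox A \ox A \ox V) \oc
  (A \ox A \ox A \ox ((m \ox V) \oc (A \ox sigma) \oc (sigma \ox V))) \oc P2 \oc P1).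
  by rewrite /P1 /P2; diagram.
rewrite cc; apply/esym.
transitivity ((m \ox V) \oc (m \ox sigma) \oc (A \ox (psi \oc (V \ox m)) \ox V) \oc
  (A \ox V \ox m \ox A \ox V) \oc (A \ox V \ox A \ox A \ox sigma) \oc
  (A \ox V \ox A \ox psi \ox V)); first diagram.
rewrite -psim.
transitivity ((m \ox V) \oc (m \ox sigma) \oc (A \ox m \ox V \ox V) \oc
  (A \ox A \ox psi \ox V) \oc (A \ox (psi \oc (V \ox m)) \ox A \ox V) \oc
  (A \ox V \ox A \ox A \ox sigma) \oc (A \ox V \ox A \ox psi \ox V)); first diagram.
rewrite -psim.
transitivity ((m \ox V) \oc ((m \oc (A \ox m)) \ox A \ox V) \oc
  (A \ox m \ox A \ox sigma) \oc (A \ox A \ox A \ox psi \ox V) \oc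
  (A \ox A \ox A \ox V \ox sigma) \oc P2 \oc P1); first by rewrite /P1 /P2; diagram.
rewrite -mA.
transitivity ((m \ox V) \oc (m \ox A \ox V) \oc ((m \oc (A \ox m)) \ox A \ox A \ox V) \oc
  (A \ox A \ox A \ox A \ox sigma) \oc (A \ox A \ox A \ox psi \ox V) \oc
  (A \ox A \ox A \ox V \ox sigma) \oc P2 \oc P1); first by rewrite /P1 /P2; diagram.
rewrite -mA.
transitivity (((m \oc (m \ox A)) \ox V) \oc (m \ox A \ox A \ox V) \oc
  (m \ox A \ox A \ox A \ox V) \oc
  (A \ox A \ox A \ox A \ox sigma) \oc (A \ox A \ox A \ox psi \ox V) \oc
  (A \ox A \ox A \ox V \ox sigma) \oc P2 \oc P1); first by rewrite /P1 /P2; diagram.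
by rewrite mA /P1 /P2; diagram.
Qed.

(** * Units of a crossed product *)

Section CrossedProductUnit.
Variables (C : strictBraidedCat) (A : ob C) (eta m : mor C) (V : ob C).
Variables (etaV psi sigma : mor C).
Hypotheses (algA : algebra A eta m) (hetaV : etaV \is_hom unit_ob ~> V).
Hypotheses (hpsi : psi \is_hom V \Ox A ~> A \Ox V).
Hypotheses (hsigma : sigma \is_hom V \Ox V ~> A \Ox V).
Hypothesis psi_etar : psi \oc (V \ox eta) = eta \ox V.

Lemma nabla_id : nabla A eta m V psi = idm (A \Ox V).
Proof.
case: algA => he hm _ m1 _; rewrite /nabla.
transitivity ((m \ox V) \oc (A \ox (psi \oc (V \ox eta)))); first diagram.
rewrite psi_etar; transitivity ((m \oc (A \ox eta)) \ox V); first diagram.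
rewrite m1; diagram.
Qed.

Lemma wcp_mul_unitr : sigma \oc (V \ox etaV) = eta \ox V ->
  wcp_mul A m V psi sigma \oc (A \ox V \ox eta \ox etaV) = idm (A \Ox V).
Proof.
case: algA => he hm _ m1 _ se; rewrite /wcp_mul.
transitivity ((m \ox V) \oc (m \ox sigma) \oc
  (A \ox (psi \oc (V \ox eta)) \ox etaV)); first diagram.
rewrite psi_etar.
transitivity ((m \ox V) \oc ((m \oc (A \ox eta)) \ox (sigma \oc (V \ox etaV)))).
  diagram.
rewrite se m1; transitivity ((m \oc (A \ox eta)) \ox V); first diagram.
rewrite m1; diagram.
Qed.

Lemma wcp_mul_unitl : psi \oc (etaV \ox A) = A \ox etaV ->
  sigma \oc (etaV \ox V) = eta \ox V ->
  wcp_mul A m V psi sigma \oc (eta \ox etaV \ox A \ox V) = idm (A \Ox V).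
Proof.
case: algA => he hm m1l m1 _ pe se; rewrite /wcp_mul.
transitivity ((m \ox V) \oc (m \ox sigma) \oc
  (eta \ox (psi \oc (etaV \ox A)) \ox V)); first diagram.
rewrite pe.
transitivity ((m \ox V) \oc ((m \oc (eta \ox A)) \ox (sigma \oc (etaV \ox V)))).
  diagram.
rewrite se m1l; transitivity ((m \oc (A \ox eta)) \ox V); first diagram.
rewrite m1; diagram.
Qed.

End CrossedProductUnit.

(** * Crossed composites of coalgebra morphisms and their projections *)

Section CrossedCoalgMor.
Variables (C : strictBraidedCat).
Variables (A H X Y Z : ob C) (m eA dA eH dH eX dX eY dY eZ dZ f g : mor C).
Hypotheses (cA : coalgebra A eA dA) (cH : coalgebra H eH dH).
Hypotheses (cX : coalgebra X eX dX) (cY : coalgebra Y eY dY) (cZ : coalgebra Z eZ dZ).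
Hypothesis cm : coalg_mor (A \Ox A) (eA \ox eA) (comul_tensor A A dA dA) A eA dA m.
Hypothesis cf : coalg_mor X eX dX (A \Ox Y) (eA \ox eY) (comul_tensor A Y dA dY) f.
Hypothesis cg : coalg_mor (Y \Ox Z) (eY \ox eZ) (comul_tensor Y Z dY dZ)
  (A \Ox H) (eA \ox eH) (comul_tensor A H dA dH) g.

(** This composite is the common shape of the conditions to be checked: [f] and [g] are taken among
    [psi] and [sigma], in all combinations but one order being followed by a precomposition. *)
Lemma crossed_coalg_mor :
  coalg_mor (X \Ox Z) (eX \ox eZ) (comul_tensor X Z dX dZ)
    (A \Ox H) (eA \ox eH) (comul_tensor A H dA dH)
    ((m \ox H) \oc (A \ox g) \oc (f \ox Z)).
Proof.
have hdA := coalg_delta cA; have hdH := coalg_delta cH.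
have hdY := coalg_delta cY; have hdZ := coalg_delta cZ.
have cAA := coalgebra_tensor cA cA; have cAH := coalgebra_tensor cA cH.
have cYZ := coalgebra_tensor cY cZ; have cAY := coalgebra_tensor cA cY.
have c1 := coalg_mor_tensor cX cAY cZ cZ cf (coalg_mor_id cZ).
have c2 := coalg_mor_tensor cA cA cYZ cAH (coalg_mor_id cA) cg.
have c3 := coalg_mor_tensor cAA cA cH cH cm (coalg_mor_id cH).
(* Multiplying the first two factors sees the source as [(A \Ox A) \Ox H], whereas [c2] ends in
   [A \Ox (A \Ox H)]. *)
rewrite (comul_tensorA hdA hdA hdH) -tmor_assoc -tob_assoc in c3.
have c23 := coalg_mor_comp (coalgebra_tensor cA cYZ) (coalgebra_tensor cA cAH) cAH c2 c3.
rewrite -(comul_tensorA hdA hdY hdZ) tmor_assoc tob_assoc in c23.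
exact: coalg_mor_comp (coalgebra_tensor cX cZ) (coalgebra_tensor cAY cZ) cAH c1 c23.
Qed.

Lemma crossed_projl : (A \ox eH) \oc ((m \ox H) \oc (A \ox g) \oc (f \ox Z)) =
  m \oc (A \ox ((A \ox eH) \oc g)) \oc (f \ox Z).
Proof.
case: cA cH cf cg cm => [heA _ _ _ _] [heH _ _ _ _] [hf _ _] [hg _ _] [hm _ _].
diagram.
Qed.

Lemma crossed_projr : (eA \ox H) \oc ((m \ox H) \oc (A \ox g) \oc (f \ox Z)) =
  ((eA \ox H) \oc g) \oc (((eA \ox Y) \oc f) \ox Z).
Proof.
case: cA cH cf cg cm => [heA _ _ _ _] [heH _ _ _ _] [hf _ _] [hg _ _] [hm me _].
transitivity (((eA \oc m) \ox H) \oc (A \ox g) \oc (f \ox Z)); first diagram.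
rewrite me; diagram.
Qed.

End CrossedCoalgMor.

(** The same diagram, with the middle braiding attached to the coproducts instead of the
    products. *)
Lemma coalg_mor_mul (C : strictBraidedCat) (D : ob C) (m e d : mor C) :
  m \is_hom D \Ox D ~> D -> coalgebra D e d ->
  d \oc m = mul_tensor D D m m \oc (d \ox d) -> e \oc m = e \ox e ->
  coalg_mor (D \Ox D) (e \ox e) (comul_tensor D D d d) D e d m.
Proof.
move=> hm [he hd _ _ _] md me; split=> //.
rewrite md /mul_tensor /comul_tensor; diagram.
Qed.

Section CoalgMorUnit.
Variables (C : strictBraidedCat) (D E : ob C) (eD dD eta eE dE : mor C).
Hypotheses (cD : coalgebra D eD dD) (cE : coalgebra E eE dE).
Hypothesis (cu : coalg_mor unit_ob unit_ob unit_ob E eE dE eta).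

(** A tensor product of coalgebra morphisms whose second source is the unit object: braiding with
    the unit is trivial, so the source coalgebra is [D] itself. *)
Lemma coalg_mor_unitr : coalg_mor D eD dD
  (D \Ox E) (eD \ox eE) (comul_tensor D E dD dE) (D \ox eta).
Proof.
have := coalg_mor_tensor cD cD (coalgebra_unit C) cE (coalg_mor_id cD) cu.
by rewrite /comul_tensor braid_unitr tob_unitr !tmor_unitr tmor_idm
  (idm_comp (coalg_delta cD)).
Qed.

Lemma coalg_mor_unitl : coalg_mor D eD dD
  (E \Ox D) (eE \ox eD) (comul_tensor E D dE dD) (eta \ox D).
Proof.
have := coalg_mor_tensor (coalgebra_unit C) cE cD cD cu (coalg_mor_id cD).
by rewrite /comul_tensor braid_unitl tob_unitl !tmor_unitl tmor_idm
  (idm_comp (coalg_delta cD)).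
Qed.

End CoalgMorUnit.

(** * Elements of strict k-modules *)

Section Elements.
Import GRing.Theory.
Local Open Scope ring_scope.
Variables (k : comPzRingType) (C : strictBraidedCat) (M : kmodules k C).

(* Elements of all the modules together: on these the pure tensor is strictly
   associative, whereas the types of [pure (pure x y) z] and
   [pure x (pure y z)] are only propositionally equal. *)
Record elt := Elt { eob : ob C; evec : M eob }.

Definition etens (u v : elt) : elt := Elt (pure M (evec u) (evec v)).

(** A relation that includes typing, so that steps compose across different bracketings without
    transporting vectors. *)
Definition maps (f : mor C) (u v : elt) : Prop :=
  Defs.hom f (eob u) (eob v) /\ ap M (eob u) (eob v) f (evec u) = evec v.

Lemma Elt_cast (X Y : ob C) (x : M X) : X = Y -> Elt (ap M X Y (idm X) x) = Elt x.
Proof. by case: Y /; rewrite ap_id. Qed.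

Lemma etensA u v w : etens (etens u v) w = etens u (etens v w).
Proof.
case: u v w => X x [Y y] [Z z]; rewrite /etens /= -pure_assoc Elt_cast //.
by rewrite tob_assoc.
Qed.

Lemma maps_ap (X Y : ob C) (f : mor C) (x : M X) :
  Defs.hom f X Y -> maps f (Elt x) (Elt (ap M X Y f x)).
Proof. by []. Qed.

Lemma maps_idm u : maps (idm (eob u)) u u.
Proof. by split; [exact: hom_idm | exact: ap_id]. Qed.

Lemma maps_comp f g u v w : maps f u v -> maps g v w -> maps (Defs.comp g f) u w.
Proof.
move=> [hf fu] [hg gv]; split; first exact: hom_comp hf hg.
by rewrite (ap_comp _ hf hg) fu gv.
Qed.

Lemma maps_tmor f g u u' v v' : maps f u v -> maps g u' v' ->
  maps (tmor f g) (etens u u') (etens v v').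
Proof.
move=> [hf fu] [hg gu]; split; first exact: hom_tmor.
by rewrite /= (ap_tmor _ _ hf hg) fu gu.
Qed.

Lemma maps_braid u v : maps (braid (eob u) (eob v)) (etens u v) (etens v u).
Proof. by split; [exact: hom_braid | exact: ap_braid]. Qed.

Lemma maps_op2 (X Y Z : ob C) (m : mor C) (x : M X) (y : M Y) :
  Defs.hom m (tob X Y) Z -> maps m (etens (Elt x) (Elt y)) (Elt (op2 M m x y : M Z)).
Proof. by []. Qed.

End Elements.

(** * The multiplication of the unified product on elements *)

Lemma linear_big_sum (k : pzRingType) (U V : lmodType k) (f : U -> V) (I : Type)
    (s : seq I) (F : I -> U) : linear f ->
  f (\sum_(i <- s) F i)%R = (\sum_(i <- s) f (F i))%R.
Proof.
move=> lf; have f0 : f 0%R = 0%R.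
  (* Linearity with scalar -1 at zero reads f 0 = - f 0 + f 0. *)
  have := lf (-1)%R 0%R 0%R.
  by rewrite GRing.scaler0 GRing.addr0 GRing.scaleN1r GRing.addNr.
elim: s => [|i s IH]; rewrite ?big_nil // !big_cons -IH.
by have := lf 1%R (F i) (\sum_(j <- s) F j)%R; rewrite !GRing.scale1r.
Qed.

(** All coproducts are gathered in the rightmost factor, where Sweedler expansions can be
    substituted; the rest acts on pure tensors. The coproduct of [phiH] produces the third copies of
    h and c. *)
Lemma wcp_mul_unified (C : strictBraidedCat) (A H : ob C)
    (muA epsA deltaA muH epsH deltaH phiH phiA tau : mor C) :
  muA \is_hom A \Ox A ~> A -> muH \is_hom H \Ox H ~> H ->
  phiA \is_hom H \Ox A ~> A -> tau \is_hom H \Ox H ~> A ->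
  coalgebra A epsA deltaA -> coalgebra H epsH deltaH ->
  coalg_mor (H \Ox A) (epsH \ox epsA) (comul_tensor H A deltaH deltaA)
    H epsH deltaH phiH ->
  wcp_mul A muA H ((phiA \ox phiH) \oc comul_tensor H A deltaH deltaA)
    ((tau \ox muH) \oc comul_tensor H H deltaH deltaH) =
  (muA \ox H) \oc (muA \ox tau \ox muH) \oc (A \ox A \ox H \ox braid H H \ox H) \oc
  (A \ox phiA \ox phiH \ox phiH \ox H \ox H) \oc
  (A \ox H \ox A \ox H \ox braid H A \ox A \ox H \ox H) \oc
  (A \ox H \ox braid (H \Ox H) A \ox A \ox A \ox H \ox H) \oc
  (A \ox ((H \ox deltaH) \oc deltaH) \ox ((A \ox deltaA) \oc deltaA) \ox deltaH).
Proof.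
move=> hmA hmH hpA ht cA cH [hpH _ pd]; have itr := comul_tensor_iterated cH cA.
case: (cA) (cH) => [_ hdA _ _ _] [_ hdH _ _ _].
have hd := comul_tensor_hom hdH hdA.
rewrite /wcp_mul [comul_tensor H H _ _]/comul_tensor.
transitivity ((muA \ox H) \oc (muA \ox tau \ox muH) \oc
  (A \ox A \ox H \ox braid H H \ox H) \oc (A \ox phiA \ox (deltaH \oc phiH) \ox deltaH) \oc
  (A \ox comul_tensor H A deltaH deltaA \ox H)); first diagram.
rewrite pd.
transitivity ((muA \ox H) \oc (muA \ox tau \ox muH) \oc
  (A \ox A \ox H \ox braid H H \ox H) \oc (A \ox phiA \ox phiH \ox phiH \ox H \ox H) \oc
  (A \ox ((H \Ox A \ox comul_tensor H A deltaH deltaA) \oc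
     comul_tensor H A deltaH deltaA) \ox deltaH)); first diagram.
rewrite itr; diagram.
Qed.

Lemma unified_product_mulP (k : comPzRingType) (C : strictBraidedCat)
    (M : kmodules k C) (A H : ob C)
    (muA epsA deltaA muH epsH deltaH phiH phiA tau : mor C) :
  muA \is_hom A \Ox A ~> A -> muH \is_hom H \Ox H ~> H ->
  phiA \is_hom H \Ox A ~> A -> tau \is_hom H \Ox H ~> A ->
  coalgebra A epsA deltaA -> coalgebra H epsH deltaH ->
  coalg_mor (H \Ox A) (epsH \ox epsA) (comul_tensor H A deltaH deltaA)
    H epsH deltaH phiH ->
  unified_product_mul M A muA deltaA H muH deltaH phiH phiA tau
    (wcp_mul A muA H ((phiA \ox phiH) \oc comul_tensor H A deltaH deltaA)
      ((tau \ox muH) \oc comul_tensor H H deltaH deltaH)).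
Proof.
move=> hmA hmH hpA ht cA cH cpH.
have muE := wcp_mul_unified hmA hmH hpA ht cA cH cpH.
set mu := wcp_mul _ _ _ _ _ in muE *; rewrite /unified_product_mul.
case: (cA) (cH) (cpH) => [_ hdA _ _ _] [_ hdH _ _ _] [hpH _ _].
(* [D] performs the coproducts and [P] everything after them; the brackets of [W] follow the nesting
   of the Sweedler expansions. *)
set P := (X in X \oc _) in muE; set D := (X in _ \oc X) in muE.
set W := (A \Ox (H \Ox (H \Ox H))) \Ox (A \Ox (A \Ox A)) \Ox (H \Ox H).
have hP : P \is_hom W ~> A \Ox H by rewrite /P /W; diagram.
move=> a c h g hs cs gs Eh Ec Eg.
pose u0 := pure M (pure M
    (pure M a (ap M H (H \Ox (H \Ox H)) ((H \ox deltaH) \oc deltaH) h))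
  (ap M A (A \Ox (A \Ox A)) ((A \ox deltaA) \oc deltaA) c)) (ap M H (H \Ox H) deltaH g).
transitivity (ap M W (A \Ox H) P u0).
  have hH3 : (H \ox deltaH) \oc deltaH \is_hom H ~> H \Ox (H \Ox H) by diagram.
  have hA3 : (A \ox deltaA) \oc deltaA \is_hom A ~> A \Ox (A \Ox A) by diagram.
  have S := maps_comp (maps_tmor (maps_tmor (maps_tmor (maps_idm (Elt a))
    (maps_ap h hH3)) (maps_ap c hA3)) (maps_ap g hdH)) (maps_ap u0 hP).
  by have := S; rewrite -[Defs.comp _ _]/(P \oc D) -muE etensA => -[].
rewrite /u0 Eh Ec Eg {u0 Eh Ec Eg}.
(* Linearity of [G] in each argument extracts the three sums and reduces the claim to pure
   tensors. *)
pose G u v w := ap M W (A \Ox H) P (pure M (pure M (pure M a u) v) w).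
have lP := @ap_linear _ _ M _ _ _ hP.
have Gl v w : linear (fun u => G u v w).
  by move=> r x y; rewrite /G pure_linearr !pure_linearl lP.
have Gm u w : linear (fun v => G u v w).
  by move=> r x y; rewrite /G pure_linearr pure_linearl lP.
have Gr u v : linear (G u v) by move=> r x y; rewrite /G pure_linearr lP.
rewrite -[LHS]/(G _ _ _) (linear_big_sum _ _ (Gl _ _)); apply: eq_bigr => t _.
rewrite (linear_big_sum _ _ (Gm _ _)); apply: eq_bigr => u _.
rewrite (linear_big_sum _ _ (Gr _ _)); apply: eq_bigr => v _.
pose e (X : ob C) (x : M X) := Elt x.
case: t u v => [[h1 h2] h3] [[c1 c2] c3] [g1 g2] /=.
have I X (x : M X) := maps_idm (e X x).
(* [S1] to [S6] follow a pure tensor through the successive factors of [P], from right to left. *)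
have S1 := maps_tmor (maps_tmor (maps_tmor (maps_tmor (maps_tmor (maps_tmor
  (I _ a) (I _ h1)) (maps_braid (etens (Elt h2) (Elt h3)) (Elt c1)))
  (I _ c2)) (I _ c3)) (I _ g1)) (I _ g2).
have S2 := maps_tmor (maps_tmor (maps_tmor (maps_tmor (maps_tmor (maps_tmor (maps_tmor
  (I _ a) (I _ h1)) (I _ c1)) (I _ h2)) (maps_braid (Elt h3) (Elt c2)))
  (I _ c3)) (I _ g1)) (I _ g2).
have S3 := maps_tmor (maps_tmor (maps_tmor (maps_tmor (maps_tmor (I _ a)
  (maps_op2 h1 c1 hpA)) (maps_op2 h2 c2 hpH)) (maps_op2 h3 c3 hpH)) (I _ g1)) (I _ g2).
set x1 := op2 _ _ _ _ in S3; set x2 := op2 _ _ _ _ in S3; set x3 := op2 _ _ _ _ in S3.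
have S4 := maps_tmor (maps_tmor (maps_tmor (maps_tmor (I _ a) (I _ x1)) (I _ x2))
  (maps_braid (Elt x3) (Elt g1))) (I _ g2).
have S5 := maps_tmor (maps_tmor (maps_op2 a x1 hmA) (maps_op2 x2 g1 ht))
  (maps_op2 x3 g2 hmH).
set y1 := op2 _ _ _ _ in S5; set y2 := op2 _ _ _ _ in S5; set y3 := op2 _ _ _ _ in S5.
have S6 := maps_tmor (maps_op2 y1 y2 hmA) (I _ y3).
rewrite !etensA in S1 S2 S3 S4 S5 S6.
have S : maps P (etens (etens (etens (Elt a) (etens (Elt h1) (etens (Elt h2) (Elt h3))))
    (etens (Elt c1) (etens (Elt c2) (Elt c3)))) (etens (Elt g1) (Elt g2)))
    (etens (Elt (op2 M muA y1 y2 : M A)) (Elt y3)).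
  rewrite !etensA.
  exact: maps_comp S1 (maps_comp S2 (maps_comp S3 (maps_comp S4 (maps_comp S5 S6)))).
by case: S.
Qed.

(** * The crossed product of an extending datum *)

Theorem mainTheorem3 (C : strictBraidedCat) (hsplit : idempotents_split C)
  (A : ob C) (etaA muA epsA deltaA : mor C)
  (hA : bialgebra A etaA muA epsA deltaA)
  (H : ob C) (etaH muH epsH deltaH : mor C) (phiH phiA tau : mor C)
  (hOmega : extending_datum A etaA muA epsA deltaA H etaH muH epsH deltaH
              phiH phiA tau)
  (hdelta : deltaH \oc muH = mul_tensor H H muH muH \oc (deltaH \ox deltaH))
  (heps : epsH \oc muH = epsH \ox epsH)
  (hmod : right_module A etaA muA H phiH)
  (psi sigma : mor C)
  (hpsi : psi = (phiA \ox phiH) \oc comul_tensor H A deltaH deltaA)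
  (hsigma : sigma = (tau \ox muH) \oc comul_tensor H H deltaH deltaH)
  (BE1 : muH \oc (muH \ox H) = muH \oc (phiH \ox H) \oc (H \ox sigma))
  (BE2 : phiA \oc (H \ox muA) = muA \oc (A \ox phiA) \oc (psi \ox A))
  (BE3 : phiH \oc (muH \ox A) = muH \oc (phiH \ox H) \oc (H \ox psi))
  (BE4 : muA \oc (A \ox tau) \oc (psi \ox H) \oc (H \ox psi) =
         muA \oc (A \ox phiA) \oc (sigma \ox A))
  (BE5 : muA \oc (A \ox tau) \oc (psi \ox H) \oc (H \ox sigma) =
         muA \oc (A \ox tau) \oc (sigma \ox H))
  (BE6 : braid A H \oc psi = (phiH \ox phiA) \oc comul_tensor H A deltaH deltaA)
  (BE7 : braid A H \oc sigma = (muH \ox tau) \oc comul_tensor H H deltaH deltaH)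
  (mu : mor C)
  (hmu : mu = (muA \ox H) \oc (muA \ox sigma) \oc (A \ox psi \ox H)) :
  weak_crossed_product A etaA muA H psi sigma mu /\
  nabla A etaA muA H psi = idm (A \Ox H) /\
  mu \oc (etaA \ox etaH \ox A \ox H) = idm (A \Ox H) /\
  mu \oc (A \ox H \ox etaA \ox etaH) = idm (A \Ox H) /\
  algebra (A \Ox H) (etaA \ox etaH) mu /\
  (forall (k : comPzRingType) (M : kmodules k C),
     unified_product_mul M A muA deltaA H muH deltaH phiH phiA tau mu).
Proof.
have [algA cA dAeta dAmu eAeta eAmu] := hA.
have [he hm mul mur massoc] := algA; have [heA hdA _ _ _] := cA.
have [heH hmH cH dHeta muHl muHr cphiH cphiA ctau] := hOmega.
move=> phiA_eta phiA_unit phiH_eta phiH_unit tau_unitr tau_unitl.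
have [hepsH hdH _ _ _] := cH.
have cmA := coalg_mor_mul hm cA dAmu eAmu; have cmH := coalg_mor_mul hmH cH hdelta heps.
have cHA := coalgebra_tensor cH cA; have cHH := coalgebra_tensor cH cH.
have cAH := coalgebra_tensor cA cH; have cHHA := coalgebra_tensor cHH cA.
have cpsi := coalg_mor_pair cHA cA cH cphiA cphiH.
rewrite -hpsi in cpsi; move: (cpsi BE6) => {}cpsi.
have csigma := coalg_mor_pair cHH cA cH ctau cmH.
rewrite -hsigma in csigma; move: (csigma BE7) => {}csigma.
have psil : (A \ox epsH) \oc psi = phiA.
  by rewrite hpsi; exact: pair_projl cHA cA cH cphiA cphiH.
have psir : (epsA \ox H) \oc psi = phiH.
  by rewrite hpsi; exact: pair_projr cHA cA cH cphiA cphiH.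
have sigmal : (A \ox epsH) \oc sigma = tau.
  by rewrite hsigma; exact: pair_projl cHH cA cH ctau cmH.
have sigmar : (epsA \ox H) \oc sigma = muH.
  by rewrite hsigma; exact: pair_projr cHH cA cH ctau cmH.
have [hpsiT _ _] := cpsi; have [hsigmaT _ _] := csigma.
have [hphiA _ _] := cphiA; have [hphiH _ _] := cphiH; have [htau _ _] := ctau.
have [_ _ modA] := hmod.
have cApsi := coalg_mor_tensor cH cH cHA cAH (coalg_mor_id cH) cpsi.
rewrite -(comul_tensorA hdH hdH hdA) -(comul_tensorA hdH hdA hdH)
  !tob_assoc !tmor_assoc in cApsi.
have cHsigma := coalg_mor_tensor cH cH cHH cAH (coalg_mor_id cH) csigma.
rewrite -(comul_tensorA hdH hdH hdH) -(comul_tensorA hdH hdA hdH)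
  !tob_assoc !tmor_assoc in cHsigma.
have cHmA := coalg_mor_tensor cH cH (coalgebra_tensor cA cA) cA (coalg_mor_id cH) cmA.
rewrite -(comul_tensorA hdH hdA hdA) !tob_assoc !tmor_assoc in cHmA.
have psi_mu : (muA \ox H) \oc (A \ox psi) \oc (psi \ox A) = psi \oc (H \ox muA).
  have cHAA := coalgebra_tensor cHA cA.
  apply: (coalg_mor_ext cHAA cA cH (crossed_coalg_mor cA cH cHA cH cA cmA cpsi cpsi)).
  - exact: coalg_mor_comp cHAA cHA cAH cHmA cpsi.
  (* The final [-psil] turns [phiA] back into a projection of [psi], as it occurs on the other
     side. *)
  - rewrite (crossed_projl cA cH cmA cpsi cpsi) psil -BE2 -psil; diagram.
  - rewrite (crossed_projr cA cH cmA cpsi cpsi) psir modA -psir; diagram.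
have twisted : twisted_condition A muA H psi sigma.
  apply: (coalg_mor_ext cHHA cA cH (crossed_coalg_mor cA cH cHH cH cA cmA csigma cpsi)).
  (* The right-hand side is a crossed composite of [psi] and [sigma] precomposed with
     [H \ox psi]. *)
  - have c := crossed_coalg_mor cA cH cHA cH cH cmA cpsi csigma.
    exact: coalg_mor_comp cHHA (coalgebra_tensor cHA cH) cAH cApsi c.
  - rewrite (crossed_projl cA cH cmA csigma cpsi) psil -BE4 -sigmal; diagram.
  - rewrite (crossed_projr cA cH cmA csigma cpsi) psir sigmar BE3.
    transitivity (((epsA \ox H) \oc ((muA \ox H) \oc (A \ox sigma) \oc (psi \ox H)))
      \oc (H \ox psi)); last diagram.
    by rewrite (crossed_projr cA cH cmA cpsi csigma) psir sigmar.
have cocycle : cocycle_condition A muA H psi sigma.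
  have cHHH := coalgebra_tensor cHH cH.
  apply: (coalg_mor_ext cHHH cA cH (crossed_coalg_mor cA cH cHH cH cH cmA csigma csigma)).
  - have c := crossed_coalg_mor cA cH cHA cH cH cmA cpsi csigma.
    exact: coalg_mor_comp cHHH (coalgebra_tensor cHA cH) cAH cHsigma c.
  - rewrite (crossed_projl cA cH cmA csigma csigma) sigmal -BE5 -sigmal; diagram.
  - rewrite (crossed_projr cA cH cmA csigma csigma) sigmar BE1.
    transitivity (((epsA \ox H) \oc ((muA \ox H) \oc (A \ox sigma) \oc (psi \ox H)))
      \oc (H \ox sigma)); last diagram.
    by rewrite (crossed_projr cA cH cmA cpsi csigma) psir sigmar.
have cetaA : coalg_mor unit_ob unit_ob unit_ob A epsA deltaA etaA.
  by split=> //; rewrite dAeta; diagram.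
(* Obtained by evaluating the counit condition of [phiA] at [etaH] and [etaA], using that [etaH]
   acts trivially on [A]. *)
have epsH_eta : epsH \oc etaH = unit_ob.
  have [_ e _] := cphiA.
  transitivity ((epsH \ox epsA) \oc (etaH \ox A) \oc etaA).
    transitivity ((epsH \oc etaH) \oc (epsA \oc etaA)); last diagram.
    rewrite eAeta; diagram.
  rewrite -e; transitivity (epsA \oc (phiA \oc (etaH \ox A)) \oc etaA); first diagram.
  rewrite phiA_unit -eAeta; diagram.
have cetaH : coalg_mor unit_ob unit_ob unit_ob H epsH deltaH etaH.
  by split=> //; rewrite dHeta; diagram.
(* [etaA \ox H] is the common value of three of the four unit laws, so its projections are computed
   once. *)
have projl_etal : (A \ox epsH) \oc (etaA \ox H) = etaA \ox epsH by diagram.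
have projr_etal : (epsA \ox H) \oc (etaA \ox H) = H.
  transitivity ((epsA \oc etaA) \ox H); first diagram.
  rewrite eAeta; diagram.
have psi_etar : psi \oc (H \ox etaA) = etaA \ox H.
  apply: (coalg_mor_ext cH cA cH _ (coalg_mor_unitl cH cA cetaA)).
  - exact: coalg_mor_comp cH cHA cAH (coalg_mor_unitr cH cA cetaA) cpsi.
  - transitivity ((A \ox epsH) \oc psi \oc (H \ox etaA)); first diagram.
    rewrite psil phiA_eta projl_etal; diagram.
  - transitivity ((epsA \ox H) \oc psi \oc (H \ox etaA)); first diagram.
    by rewrite psir phiH_unit projr_etal.
have psi_etal : psi \oc (etaH \ox A) = A \ox etaH.
  apply: (coalg_mor_ext cA cA cH _ (coalg_mor_unitr cA cH cetaH)).
  - exact: coalg_mor_comp cA cHA cAH (coalg_mor_unitl cA cH cetaH) cpsi.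
  - transitivity ((A \ox epsH) \oc psi \oc (etaH \ox A)); first diagram.
    rewrite psil phiA_unit; transitivity (A \ox (epsH \oc etaH)); last diagram.
    rewrite epsH_eta; diagram.
  - transitivity ((epsA \ox H) \oc psi \oc (etaH \ox A)); first diagram.
    rewrite psir phiH_eta; diagram.
have sigma_etal : sigma \oc (etaH \ox H) = etaA \ox H.
  apply: (coalg_mor_ext cH cA cH _ (coalg_mor_unitl cH cA cetaA)).
  - exact: coalg_mor_comp cH cHH cAH (coalg_mor_unitl cH cH cetaH) csigma.
  - transitivity ((A \ox epsH) \oc sigma \oc (etaH \ox H)); first diagram.
    by rewrite sigmal tau_unitl projl_etal.
  - transitivity ((epsA \ox H) \oc sigma \oc (etaH \ox H)); first diagram.
    by rewrite sigmar muHl projr_etal.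
have sigma_etar : sigma \oc (H \ox etaH) = etaA \ox H.
  apply: (coalg_mor_ext cH cA cH _ (coalg_mor_unitl cH cA cetaA)).
  - exact: coalg_mor_comp cH cHH cAH (coalg_mor_unitr cH cH cetaH) csigma.
  - transitivity ((A \ox epsH) \oc sigma \oc (H \ox etaH)); first diagram.
    by rewrite sigmal tau_unitr projl_etal.
  - transitivity ((epsA \ox H) \oc sigma \oc (H \ox etaH)); first diagram.
    by rewrite sigmar muHr projr_etal.
have nablaE := nabla_id algA hpsiT psi_etar.
have unitr := wcp_mul_unitr algA heH hpsiT hsigmaT psi_etar sigma_etar.
have unitl := wcp_mul_unitl algA heH hpsiT hsigmaT psi_etal sigma_etal.
(* The requirement that the idempotent fix [sigma] is immediate from [nablaE]. *)
have crossed : weak_crossed_product A etaA muA H psi sigma mu.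
  by split=> //; split=> //; rewrite nablaE (idm_comp hsigmaT).
have muE : mu = wcp_mul A muA H psi sigma := wcp_mulE crossed.
rewrite -muE in unitr unitl.
do 5!split=> //.
- rewrite hmu; split; first diagram.
  + diagram.
  + by rewrite -hmu -[RHS]unitl -!tmor_assoc tmor_idm.
  + by rewrite -hmu -[RHS]unitr !tmor_assoc tmor_idm.
  + by rewrite -hmu (wcp_mul_assoc crossed).
- move=> k M; rewrite muE hpsi hsigma.
  exact: unified_product_mulP hm hmH hphiA htau cA cH cphiH.
Qed.
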